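(* Consider the problem $$\begin{cases}\mu\left(\dfrac{\partial^2u}{\partial x^2}-\dfrac{\partial u}{\partial t}\right)=-u\dfrac{\partial u}{\partial x}+f(t)u,& x\in(0,1),\ t\in\mathbb R_+,\\ u(0,t,\mu)=u^0(t),\quad u(1,t,\mu)=u^1(t),\quad u(x,t,\mu)=u(x,t+T,\mu),\end{cases}$$ with unknown $T$-periodic coefficient $f=f(t)$, and suppose the standing assumptions listed in the context hold. Let $\mathscr T=[0,T]$ and let $f^{\epsilon_1}$ be the function $$f^{\epsilon_1}=\arg\min_{v\in C^1(\mathscr T)}\frac1{k+1}\sum_{i=0}^k\big(v(t_i)-f_i^\delta\big)^2+\epsilon_1\left\|\frac{\partial^2v}{\partial t^2}\right\|_{L^2(\mathscr T)},\qquad f_i^\delta=\frac{u_i^{0,\delta}+u_i^{1,\delta}}{1-2x_{t.p.,i}^\delta},$$ with data and $\epsilon_1$ as described in the context. Then $f^{\epsilon_1}$ is a stable approximation to the exact coefficient function $f$, and $$\|f-f^{\epsilon_1}\|_{L^2(\mathscr T)}=\mathcal O\big(\mu|\ln\mu|+h_1+\sqrt\delta\big).$$ Moreover, if $\mu=\mathcal O(\delta^{\varepsilon_1+1/2})$ for some constant $\varepsilon_1>0$ and $h_1=\mathcal O(\sqrt\delta)$, then $$\|f-f^{\epsilon_1}\|_{L^2(\mathscr T)}=\mathcal O(\sqrt\delta).$$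
   Context: Data. $t_i=iT/k$, $0\le i\le k$, $h_1=\max_{0\le i\le k-1}(t_{i+1}-t_i)$, $\delta>0$ is the noise level, and for all $0\le i\le k$ $$|u_i^{0,\delta}-u^0(t_i)|\le\delta,\quad|u_i^{1,\delta}-u^1(t_i)|\le\delta,\quad|x_{t.p.,i}^\delta-x_{t.p.}(t_i)|\le\delta.$$ The regularization parameter $\epsilon_1$ is chosen so that $\frac1{k+1}\sum_{i=0}^k(f^{\epsilon_1}(t_i)-f_i^\delta)^2=\delta^2$. (The parameter $\epsilon_1$ is unrelated to the exponent constant $\varepsilon_1$.) Standing assumptions. $f,u^0,u^1$ are $T$-periodic; $f$, $u^0$, $u^1$, $u_{init}$ are sufficiently smooth (for an integer $n\ge0$: $f,u^0,u^1\in C^{n+2}(\mathbb R)$, $u_{init}\in C^{n+3}[0,1]$); $0<\mu\ll1$. With $\varphi^l(x,t)=u^0(t)+xf(t)$, $\varphi^r(x,t)=u^1(t)-(1-x)f(t)$: (i) $\max_tu^0(t)<\min\{0,-\max_{x\in[0,1],t}xf(t)\}$, $\min_tu^1(t)>\max\{0,\max_{x\in[0,1],t}(1-x)f(t)\}$, and $u^1(t)-u^0(t)>2\mu^\theta$ for all $t\in\mathbb R_+$ and some fixed $\theta\in(0,1)$; (ii) there is a smooth function $x_0(t)$, periodic in $t$, with $0<x_0(t)<1$, which for every $t\in\mathbb R_+$ is the unique root of $I(x,t):=(\varphi^l(x,t))^2-(\varphi^r(x,t))^2=0$, and $\partial_xI(x_0(t),t)<0$; equivalently to $I(x_0(t),t)=0$,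 $x_0(t)=-\frac{u^0(t)+u^1(t)-f(t)}{2f(t)}$, so that $f(t)=\frac{u^0(t)+u^1(t)}{1-2x_0(t)}$ when $x_0(t)\ne\frac12$; (iii) $u_{init}(x)=u(x,0,\mu)$ satisfies $u_{init}(x)=U_0(x,0)+\mathcal O(\mu)$, where, with $\xi_0=(x-x_0(t))/\mu$ and $\varphi^{l,r}_0:=\varphi^{l,r}(x_0(t),t)$, $$U_0(x,t)=\begin{cases}\varphi^l(x,t)-\dfrac{2\varphi^l_0}{1-\frac{\varphi^r_0+3\varphi^l_0}{\varphi^r_0-\varphi^l_0}e^{\varphi^l_0\xi_0}},&0\le x\le x_0(t),\\[3mm]\varphi^r(x,t)-\dfrac{2\varphi^r_0}{1-\frac{\varphi^l_0+3\varphi^r_0}{\varphi^l_0-\varphi^r_0}e^{\varphi^r_0\xi_0}},&x_0(t)\le x\le1;\end{cases}$$ (iv) there is $a\in(0,0.5)$ such that $0<x_{t.p.}(t)<0.5-a$ or $0.5+a<x_{t.p.}(t)<1$ for $t\in\mathbb R_+$. Here $u$ is the solution with an internal transition layer: at each $t$ it is close to $\varphi^l$ to the left of, and close to $\varphi^r$ to the right of, a small neighbourhood of the transition point $x_{t.p.}(t)$, with a rapid transition inside this neighbourhood; under these assumptions it exists and is unique. The transition point $x_{t.p.}(t)$ is a point with $u(x_{t.p.}(t),t,\mu)=\tfrac12(\varphi^l+\varphi^r)(x_{t.p.}(t),t)$. The constants in $\mathcal O$ do not depend on $\mu,h_1,\delta$. ''Stable approximation'' is quantified by the stated error estimates. 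*)

(* Defs.v *)
From HB Require Import structures.
From mathcomp Require Import all_boot all_order all_algebra.
From mathcomp Require Import all_classical all_reals all_analysis.
Set Implicit Arguments.
Unset Strict Implicit.
Unset Printing Implicit Defensive.
Import Order.TTheory GRing.Theory Num.Theory.
Import numFieldNormedType.Exports.
Local Open Scope classical_set_scope.
Local Open Scope ring_scope.

Definition Ck (R : realType) (m : nat) (g : R -> R) : Prop :=
  (forall j, (j < m)%N -> forall x : R, derivable (derive1n j g) x 1) /\
  continuous (derive1n m g).

(* [G 0, ..., G m] are the successive derivatives of [G 0] on ]a, b[, extended
   continuously to [a, b]. *)
Definition itv_jet (R : realType) (a b : R) (m : nat) (G : nat -> R -> R) : Prop :=
  (forall j, (j <= m)%N -> {within `[a, b], continuous (G j)}) /\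
  (forall j, (j < m)%N -> forall x : R, x \in `]a, b[ -> is_derive x 1 (G j) (G j.+1 x)).

Definition Ck_itv (R : realType) (a b : R) (m : nat) (g : R -> R) : Prop :=
  exists2 G, G 0%N = g & itv_jet a b m G.

Definition dx (R : realType) (w : R -> R -> R) (x t : R) : R := derive1 (w^~ t) x.
Definition dt (R : realType) (w : R -> R -> R) (x t : R) : R := derive1 (w x) t.

Definition classical_regularity (R : realType) (w : R -> R -> R) : Prop :=
  {within `[0, 1] `*` `[0, +oo[, continuous (fun p : R * R => w p.1 p.2)} /\
  forall x t : R, 0 < x < 1 -> 0 < t ->
    [/\ derivable (w^~ t) x 1, derivable ((dx w)^~ t) x 1 & derivable (w x) t 1] /\
    [/\ {for (x, t), continuous (fun p : R * R => dx w p.1 p.2)},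
        {for (x, t), continuous (fun p : R * R => dx (dx w) p.1 p.2)} &
        {for (x, t), continuous (fun p : R * R => dt w p.1 p.2)}].

Definition solves_problem (R : realType) (T mu : R) (f u0 u1 : R -> R)
    (w : R -> R -> R) : Prop :=
  [/\ classical_regularity w,
      forall x t : R, 0 < x < 1 -> 0 < t ->
        mu * (dx (dx w) x t - dt w x t) = - w x t * dx w x t + f t * w x t,
      forall t : R, 0 <= t -> w 0 t = u0 t,
      forall t : R, 0 <= t -> w 1 t = u1 t &
      forall x t : R, 0 <= x <= 1 -> 0 <= t -> w x t = w x (t + T)].

Definition phil (R : realType) (f u0 : R -> R) (x t : R) : R := u0 t + x * f t.
Definition phir (R : realType) (f u1 : R -> R) (x t : R) : R :=
  u1 t - (1 - x) * f t.

Definition Ifun (R : realType) (f u0 u1 : R -> R) (x t : R) : R :=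
  phil f u0 x t ^+ 2 - phir f u1 x t ^+ 2.

(* By continuity and periodicity the suprema and infima below are attained. *)
Definition sign_condition (R : realType) (mubar theta : R) (f u0 u1 : R -> R) : Prop :=
  [/\ sup [set u0 t | t in `[0, +oo[] <
        Num.min 0 (- sup [set x * f t | x in `[0, 1] & t in `[0, +oo[]),
      inf [set u1 t | t in `[0, +oo[] >
        Num.max 0 (sup [set (1 - x) * f t | x in `[0, 1] & t in `[0, +oo[]) &
      forall mu t : R, 0 < mu <= mubar -> 0 <= t -> u1 t - u0 t > 2 * mu `^ theta].

Definition limit_layer_position (R : realType) (f u0 u1 x0 : R -> R) : Prop :=
  forall t : R, 0 <= t ->
    [/\ 0 < x0 t < 1,
        forall x : R, 0 <= x <= 1 -> (Ifun f u0 u1 x t = 0 <-> x = x0 t) &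
        dx (Ifun f u0 u1) (x0 t) t < 0].

Definition U0 (R : realType) (f u0 u1 x0 : R -> R) (mu x t : R) : R :=
  let xi := (x - x0 t) / mu in
  let l0 := phil f u0 (x0 t) t in
  let r0 := phir f u1 (x0 t) t in
  if x <= x0 t then
    phil f u0 x t - 2 * l0 / (1 - (r0 + 3 * l0) / (r0 - l0) * expR (l0 * xi))
  else
    phir f u1 x t - 2 * r0 / (1 - (l0 + 3 * r0) / (l0 - r0) * expR (r0 * xi)).

Definition initial_condition (R : realType) (mubar : R) (f u0 u1 x0 : R -> R)
    (u : R -> R -> R -> R) : Prop :=
  exists C : R, forall mu x : R, 0 < mu <= mubar -> 0 <= x <= 1 ->
    `|u x 0 mu - U0 f u0 u1 x0 mu x 0| <= C * mu.

Definition transition_point (R : realType) (mubar : R) (f u0 u1 : R -> R)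
    (u : R -> R -> R -> R) (xtp : R -> R -> R) : Prop :=
  forall mu t : R, 0 < mu <= mubar -> 0 <= t ->
    0 < xtp t mu < 1 /\
    u (xtp t mu) t mu =
      (phil f u0 (xtp t mu) t + phir f u1 (xtp t mu) t) / 2.

(* As mu tends to 0, the solution is uniformly close to phil (resp. phir) to the
   left (resp. right) of arbitrarily small neighbourhoods of the transition
   point, so that the whole transition takes place inside them. *)
Definition internal_layer (R : realType) (mubar : R) (f u0 u1 : R -> R)
    (u : R -> R -> R -> R) (xtp : R -> R -> R) : Prop :=
  forall eta : R, 0 < eta -> exists2 mu1 : R, 0 < mu1 <= mubar &
    forall mu x t : R, 0 < mu <= mu1 -> 0 <= x <= 1 -> 0 <= t ->
      (x <= xtp t mu - eta -> `|u x t mu - phil f u0 x t| <= eta) /\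
      (xtp t mu + eta <= x -> `|u x t mu - phir f u1 x t| <= eta).

Definition away_from_middle (R : realType) (mubar a : R) (xtp : R -> R -> R) : Prop :=
  forall mu t : R, 0 < mu <= mubar -> 0 <= t ->
    0 < xtp t mu < 1 / 2 - a \/ 1 / 2 + a < xtp t mu < 1.

Definition L2norm (R : realType) (T : R) (g : R -> R) : \bar R :=
  Lnorm (@lebesgue_measure R) 2%:E (EFin \o (g \_ `[0, T])).

(* v is in C^1([0, T]) and its distributional second derivative is the square
   integrable function g, i.e. v' is absolutely continuous with derivative g. *)
Definition L2_second_derivative (R : realType) (T : R) (v g : R -> R) : Prop :=
  [/\ measurable_fun `[0, T] g, (L2norm T g < +oo)%E &
      exists G, [/\ G 0%N = v, itv_jet 0 T 1 G &
        forall t : R, 0 <= t <= T ->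
          G 1%N t = G 1%N 0 + \int[@lebesgue_measure R]_(s in `[0, t]) g s]].

(* The L2 norm of v'', equal to +oo when v'' is not in L2 (infimum over the empty
   set); otherwise g is unique up to a null set. *)
Definition penalty (R : realType) (T : R) (v : R -> R) : \bar R :=
  ereal_inf [set L2norm T g | g in L2_second_derivative T v].

Definition grid (R : realType) (T : R) (k i : nat) : R := i%:R * T / k%:R.

Definition meshsize (R : realType) (T : R) (k : nat) : R :=
  \big[Num.max/0]_(i < k) (grid T k i.+1 - grid T k i).

Definition misfit (R : realType) (T : R) (k : nat) (d : 'I_k.+1 -> R) (v : R -> R) : R :=
  k.+1%:R^-1 * \sum_(i < k.+1) (v (grid T k i) - d i) ^+ 2.

Definition tikhonov (R : realType) (T eps : R) (k : nat) (d : 'I_k.+1 -> R)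
    (v : R -> R) : \bar R :=
  ((misfit T d v)%:E + eps%:E * penalty T v)%E.

Definition is_minimizer (R : realType) (T eps : R) (k : nat) (d : 'I_k.+1 -> R)
    (v : R -> R) : Prop :=
  Ck_itv 0 T 1 v /\
  forall w, Ck_itv 0 T 1 w -> (tikhonov T eps d v <= tikhonov T eps d w)%E.

Definition noisy (R : realType) (T delta : R) (k : nat) (d : 'I_k.+1 -> R)
    (g : R -> R) : Prop :=
  forall i, `|d i - g (grid T k i)| <= delta.

Definition source_data (R : realType) (k : nat) (u0d u1d xd : 'I_k.+1 -> R)
    (i : 'I_k.+1) : R :=
  (u0d i + u1d i) / (1 - 2 * xd i).

(* feps is obtained from some data of noise level delta, with the parameter eps
   chosen by the discrepancy principle. *)
Definition is_reconstruction (R : realType) (T delta : R) (k : nat)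
    (u0 u1 xtp feps : R -> R) : Prop :=
  exists (u0d u1d xd : 'I_k.+1 -> R) (eps : R),
    [/\ noisy T delta u0d u0, noisy T delta u1d u1 & noisy T delta xd xtp] /\
    [/\ 0 < eps,
        is_minimizer T eps (source_data u0d u1d xd) feps &
        misfit T (source_data u0d u1d xd) feps = delta ^+ 2].

(* Main.v *)
(* Writing [v = u - f(t) (x - x0(t))], the transition point is a zero of [v], and
   [v] is a symmetric shock from [-A] to [A], [A = phir(x0(t), t)].  Shifting the
   explicit shock [A tanh(A y / (2 mu))] by [O(mu |ln mu|)] and adding a small
   V-shaped correction gives a strict subsolution, which stays below [v] by
   comparison from [t = 0]; together with the reflection [v -> - v(1 - x)] this
   traps the zeros of [v] at distance [O(mu |ln mu|)] from [x0].

   Given the values of [feps] at the nodes, minimality means minimal penalty,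
   whatever [eps] is.  Comparing with [f] plus [C^2] bumps carrying the nodal
   errors bounds [h^2 |feps''|] by [h^2] plus the discrete L2 norm of these errors,
   and the latter is controlled by the discrepancy principle and by the first
   part.  The values between the nodes are recovered from the nodal ones up to
   [h^2 |f'' - feps''|]. *)
Require Import Defs.
From HB Require Import structures.
From mathcomp Require Import all_boot all_order all_algebra.
From mathcomp Require Import all_classical all_reals all_analysis.
From mathcomp Require Import measurable_realfun.
From mathcomp Require Import ring lra.
Set Implicit Arguments.
Unset Strict Implicit.
Unset Printing Implicit Defensive.
Import Order.TTheory GRing.Theory Num.Theory.
Import numFieldNormedType.Exports.
Local Open Scope classical_set_scope.
Local Open Scope ring_scope.

(** * Parabolic comparison *)

(** Strictness of the subsolution is what makes comparison work for a quasilinear equation: at a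
    first contact from below the values and the slopes agree, so the products [v * vx] coincide and
    only [mu * (vxx - vt)] is compared. No linearization and no monotonicity in [v] is needed. The
    logarithm comes from the left of the shock centre, where transport has the wrong sign: the tail
    of the shock must be a higher power of [mu] there, and an exponential of rate [1 / mu] gets that
    small only at a distance of order [mu |ln mu|]. In the reconstruction, the obstacle is that
    nothing ties the mesh width [h] to the noise. Bumps of width [h] cost a factor [h^-2] in the
    second derivative, which may be huge; recovering the values between the nodes costs [h^2] times
    the second derivative. The two factors cancel exactly, so nodal errors return with a bounded
    constant. The error obtained is of order [delta + mu |ln mu| + h^2]; the rate [sqrt delta]
    enters through [delta <= sqrt delta]. *)

Lemma compact_sublevel (V : topologicalType) (R : realType) (K : set V)
    (z : V -> R) : hausdorff_space V -> compact K ->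
  {within K, continuous z} -> compact (K `&` [set p | z p <= 0]).
Proof.
move=> hV cK cz.
apply: (@subclosed_compact _ _ K) => //.
move=> p clp.
have Kp : K p.
  by apply: (compact_closed hV cK) => B /clp[q [[Kq _] Bq]]; exists q.
split=> //=; rewrite leNgt; apply/negP => zp.
have /subspace_continuousP/(_ p Kp) zcvg := cz.
have [q [[Kq zq] /(_ Kq)]] := clp _ (cvgr_gt _ zcvg _ zp).
by rewrite ltNge zq.
Qed.

(** The time coordinate attains its minimum on the compact set where [z] is nonpositive. At that
    time [z] is nonnegative on the whole segment, as a left limit of positive values, so the point
    found is an interior zero to which the last hypothesis applies. *)
Lemma first_touching (R : realType) (T : R) (z : R -> R -> R) :
  {within `[0, 1] `*` `[0, T], continuous (fun p : R * R => z p.1 p.2)} ->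
  (forall x : R, 0 <= x <= 1 -> 0 < z x 0) ->
  (forall t : R, 0 <= t <= T -> 0 < z 0 t /\ 0 < z 1 t) ->
  (forall x t : R, 0 < x < 1 -> 0 < t <= T -> z x t = 0 ->
     (forall y : R, 0 <= y <= 1 -> 0 <= z y t) ->
     (forall s : R, 0 <= s <= t -> 0 <= z x s) -> False) ->
  forall x t : R, 0 <= x <= 1 -> 0 <= t <= T -> 0 < z x t.
Proof.
move=> cz z0 zb touch x t x01 t0T; rewrite ltNge; apply/negP => zxt.
have cK : compact (`[0, 1] `*` `[0, T] : set (R * R)).
  by apply: compact_setX; exact: segment_compact.
have hRR : hausdorff_space (R * R)%type by exact: norm_hausdorff.
have cS := compact_sublevel hRR cK cz.
set S := (X in compact X) in cS.
have S0 : S !=set0 by exists (x, t); split; [split; rewrite /= in_itv|].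
have csnd : continuous (snd : R * R -> R) by move=> p; exact: cvg_snd.
have [[x1 t1]] := @compact_EVT_min _ R snd S S0 cS (continuous_subspaceT csnd).
rewrite inE => -[[/=]]; rewrite !in_itv/= => x101 t10T z1 t1min.
have zpos (y s : R) : 0 <= y <= 1 -> 0 <= s < t1 -> 0 < z y s.
  move=> y01 /andP[s0 st1]; rewrite ltNge; apply/negP => zys.
  have /t1min /= : (y, s) \in S.
    rewrite inE; split=> //; split; rewrite /= in_itv//=.
    by rewrite s0 (le_trans (ltW st1))//; case/andP: t10T.
  by rewrite leNgt st1.
have t1_gt0 : 0 < t1.
  have /andP[t10 _] := t10T; rewrite lt_neqAle t10 andbT; apply/eqP => t10E.
  by move: z1; rewrite -t10E leNgt z0.
have [zb0 zb1] := zb _ t10T.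
have x1_in : 0 < x1 < 1.
  have /andP[x10 x11] := x101; rewrite !lt_neqAle x10 x11 !andbT.
  apply/andP; split; apply/eqP => xE; move: z1; rewrite leNgt.
    by rewrite -xE zb0.
  by rewrite xE zb1.
have znneg (y : R) : 0 <= y <= 1 -> 0 <= z y t1.
  move=> y01.
  have Ky : (`[0, 1] `*` `[0, T]) (y, t1) by split; rewrite /= in_itv.
  have /subspace_continuousP/(_ _ Ky) zcvg := cz.
  have zl : z y s @[s --> t1^'-] --> z y t1.
    apply: (cvg_comp (fun s => (y, s)) _ _ zcvg) => A /= [[B1 B2] /= [hB1 hB2] hB].
    rewrite /nbhs/=; near=> s.
    apply: hB; [split=> /=|split; rewrite /= in_itv//=].
    - exact: nbhs_singleton.
    - by near: s; apply: cvg_within; exact: hB2.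
    - apply/andP; split; first by near: s; exact: nbhs_left_ge.
      have /andP[_] := t10T; apply: le_trans.
      by near: s; exact: nbhs_left_le.
  apply: (cvgr_to_ge zl); near=> s; apply/ltW/zpos => //.
  apply/andP; split; first by near: s; exact: nbhs_left_ge.
  by near: s; exact: nbhs_left_lt.
apply: (touch x1 t1) => //.
- by rewrite t1_gt0; case/andP: t10T.
- by apply/eqP; rewrite eq_le z1 znneg.
- move=> s /andP[s0]; rewrite le_eqVlt => /predU1P[->|st1]; first exact: znneg.
  by apply/ltW/zpos => //; rewrite s0.
Unshelve. all: by end_near. Qed.

Lemma difference_quotient_gt0 (R : realType) (h : R -> R) (t d : R) :
  is_derive t 1 h d -> 0 < d ->
  exists2 e : R, 0 < e &
    forall k : R, `|k| < e -> k != 0 -> 0 < k^-1 * (h (t + k) - h t).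
Proof.
move=> [dh dE] d0.
have cv : (fun k : R => k^-1 *: (h (k *: 1 + t) - h t)) @ 0^' --> d.
  by rewrite -dE; exact: dh.
have : \forall k \near 0^', 0 < k^-1 *: (h (k *: 1 + t) - h t).
  exact: (cvgr_gt _ cv _ d0).
move=> /nbhs_ballP[e /= e0 he].
exists e => // k ke k0.
have := he k _ k0; rewrite /= /ball/= sub0r normrN => /(_ ke).
by rewrite [k%:A]mulr1 [k + t]addrC.
Qed.

Lemma derive_left_le0 (R : realType) (h : R -> R) (t d : R) :
  0 < t -> is_derive t 1 h d -> h t = 0 ->
  (forall s : R, 0 <= s <= t -> 0 <= h s) -> d <= 0.
Proof.
move=> t0 dh ht hs; rewrite leNgt; apply/negP => d0.
have [e e0 he] := difference_quotient_gt0 dh d0.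
pose k := Num.min (e / 2) t.
have k0 : 0 < k by rewrite lt_min t0 divr_gt0.
have ke : k < e by rewrite gt_min ltr_pdivrMr// ltr_pMr// ltr1n.
have kt : k <= t by rewrite ge_min lexx orbT.
have := he (- k); rewrite normrN gtr0_norm// => /(_ ke).
rewrite oppr_eq0 gt_eqF// => /(_ isT); rewrite ht subr0 invrN mulNr oppr_gt0.
rewrite pmulr_rlt0 ?invr_gt0// ltNge hs//.
by rewrite subr_ge0 kt lerBlDr lerDl ltW.
Qed.

(** If [d2] were negative, [dz] would be negative just to the right of its zero [x], and the mean
    value theorem would give a smaller value of [z] there. *)
Lemma second_derivative_test (R : realType) (z dz : R -> R) (x d2 : R) :
  0 < x < 1 ->
  (forall y : R, 0 < y < 1 -> is_derive y 1 z (dz y)) ->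
  is_derive x 1 dz d2 ->
  (forall y : R, 0 <= y <= 1 -> z x <= z y) ->
  dz x = 0 /\ 0 <= d2.
Proof.
move=> x01 dzP d2P zmin.
have dz0 : dz x = 0.
  have h : is_derive x 1 z 0.
    apply: (@derive1_at_min _ z 0 1) => // t; rewrite in_itv/= => t01.
      exact: (@ex_derive _ _ _ _ _ _ _ (dzP t t01)).
    by case/andP: t01 => t0 t1; apply: zmin; rewrite !ltW.
  by rewrite -(@derive_val _ _ _ _ _ _ _ (dzP x x01)) derive_val.
split=> //; rewrite leNgt; apply/negP => d2_lt0.
have Nd2P : is_derive x 1 (- dz) (- d2) by exact: is_deriveN.
have [|e e0 he] := difference_quotient_gt0 Nd2P; first by rewrite oppr_gt0.
have /andP[x0 x1] := x01.
pose k := Num.min (e / 2) ((1 - x) / 2).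
have k0 : 0 < k by rewrite lt_min !divr_gt0 ?subr_gt0.
have ke : k < e by rewrite gt_min ltr_pdivrMr// ltr_pMr// ltr1n.
have kx : x + k < 1.
  have : k <= (1 - x) / 2 by rewrite ge_min lexx orbT.
  lra.
have dzN y : x < y <= x + k -> dz y < 0.
  move=> /andP[xy yk].
  have := he (y - x); rewrite gtr0_norm ?subr_gt0// subrKC gt_eqF ?subr_gt0//.
  have NE u : (- dz) u = - dz u by [].
  rewrite !NE dz0 oppr0 subr0 pmulr_rgt0 ?invr_gt0 ?subr_gt0// oppr_gt0.
  by apply=> //; lra.
have zc : {within `[x, x + k], continuous z}.
  apply: derivable_within_continuous => y; rewrite in_itv/= => /andP[xy yk].
  have y01 : 0 < y < 1 by lra.
  exact: (@ex_derive _ _ _ _ _ _ _ (dzP y y01)).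
have [||c] := @MVT _ z dz x (x + k) _ _ zc.
- by rewrite ltrDl.
- by move=> y; rewrite in_itv/= => /andP[xy yk]; apply: dzP; lra.
rewrite in_itv/= addrAC subrr add0r => /andP[xc ck] zE.
have : z x <= z (x + k) by apply: zmin; lra.
rewrite -subr_ge0 zE pmulr_lge0// leNgt dzN//; lra.
Qed.

(** * The shock barrier *)

(** This is tanh(z / 2), in the form that matches the exponentials of [U0]. *)
Definition shock (R : realType) (z : R) : R := 1 - 2 / (1 + expR z).

(** [P] is the slope of the shock where its value is [th]. The bound [P <= 2 * E] is the exponential
    tail on the left; the last one is a dichotomy: where the slope is small, [th] is close to 1 or
    -1. *)
Lemma shock_bounds (R : realType) (E th P : R) : 0 < E ->
  th = 1 - 2 / (1 + E) -> P = (1 - th ^+ 2) / 2 ->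
  [/\ th < 1, -1 < th, 0 < P, P <= 2 * E & 1 - `|th| <= 2 * P].
Proof.
move=> E0 thE PE.
have th_lt1 : th < 1 by rewrite thE ltrBlDr ltrDl divr_gt0// addr_gt0.
have th_gtN1 : -1 < th.
  rewrite thE ltrBrDr -ltrBrDl opprK ltr_pdivrMr ?addr_gt0//.
  by rewrite mulrDr mulr1 ltrDl mulr_gt0.
split=> //.
- rewrite PE; have : 0 < (1 - th) * (1 + th) by apply: mulr_gt0; lra.
  rewrite (_ : _ * _ = 1 - th ^+ 2); last by ring.
  by move=> h; rewrite divr_gt0.
- have -> : P = 2 * E / (1 + E) ^+ 2.
    by rewrite PE thE; field; rewrite gt_eqF// addr_gt0.
  rewrite ler_pdivrMr ?exprn_gt0 ?addr_gt0// ler_peMr ?mulr_ge0 ?ltW//.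
  by rewrite exprn_egt1 ?ltrDl.
- have h : `|th| <= 1 by rewrite ler_norml !ltW.
  have := ler_piMl (normr_ge0 th) h; rewrite -normrM -expr2 ger0_norm ?sqr_ge0//.
  by rewrite PE; lra.
Qed.

Lemma convex_ge (R : realType) (t x y a : R) :
  0 <= t -> t <= 1 -> a <= x -> a <= y -> a <= (1 - t) * x + t * y.
Proof.
move=> t0 t1 ax ay.
have : 0 <= (1 - t) * (x - a) by rewrite mulr_ge0 ?subr_ge0.
have : 0 <= t * (y - a) by rewrite mulr_ge0 ?subr_ge0.
lra.
Qed.

(** Half of the exponential absorbs the factor [z]. This serves both for the tail of the shock and
    for products of [mu] with its logarithm. *)
Lemma mul_expRN_le (R : realType) (z : R) : z * expR (- z) <= 2 * expR (- (z / 2)).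
Proof.
have -> : expR (- z) = expR (- (z / 2)) * expR (- (z / 2)).
  by rewrite -expRD; congr expR; field.
rewrite mulrA ler_pM2r ?expR_gt0//.
have h : z / 2 * expR (- (z / 2)) <= 1.
  rewrite expRN ler_pdivrMr ?expR_gt0// mul1r.
  by apply: le_trans (expR_ge1Dx _); lra.
lra.
Qed.

(* [sg] is the side of the shock ([1] on the right), and the three terms on the
   right are the transport, the slope of the correction and the time derivative.
   Where the shock is steep the shift [s] makes the transport term dominate, by a
   factor [L]; where it is flat the slope [sg * mu * M] does.  On the left beyond
   [s / 4], where transport has the wrong sign, [s = 16 B mu L] makes the tail of
   the shock [O(mu^2)]. *)
Lemma barrier_residual_gt0 (R : realType)
    (B C0 mu L s A dA F dF dX y sg M c E th P q g : R) :
  M = 16 * B ^+ 3 -> c = mu * (2 * M + C0 + 1) ->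
  s = 16 * B * (mu * L) ->
  E = expR (A * y / mu) -> th = 1 - 2 / (1 + E) -> P = (1 - th ^+ 2) / 2 ->
  dA = A * q -> g = dF * (y + s) - F * dX ->
  1 <= B -> 0 <= C0 -> 0 < mu ->
  1 <= A * B -> A <= B -> 1 <= F * B -> F <= B ->
  `|dA| <= B -> `|dF| <= B -> `|dX| <= B ->
  `|y + s| <= 1 -> s <= 1 ->
  B ^+ 2 <= L -> 2 * M + C0 + 1 + B <= 8 * L ->
  mu * (8 * B ^+ 2) <= 1 -> mu * M * B <= 1 ->
  M * (2 * (mu * M) + B * s) <= 1 ->
  expR (- (2 * L)) <= mu ^+ 2 ->
  sg = 1 /\ 0 <= y \/ sg = -1 /\ y <= 0 ->
  mu * g < (sg * (mu * M * y) - c + F * (y + s)) * (A ^+ 2 * P / mu)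
    + sg * (mu * M) * (A * th + sg * (mu * M * y) - c + F * (y + s))
    - mu * (dA * th + A * P * (dA * y - A * dX) / mu - sg * (mu * M * dX)).
Proof.
move=> ME cE sE EE thE PdE dAE gE B1 C00 mu0 A1 AB F1 FB dAB dFB dXB ys1 s1 LB LC
  muB muM Ms mu_expR sgy.
have B0 : 0 < B by exact: lt_le_trans B1.
have A0 : 0 < A by rewrite -(pmulr_lgt0 _ B0); exact: lt_le_trans A1.
have F0 : 0 < F by rewrite -(pmulr_lgt0 _ B0); exact: lt_le_trans F1.
have M0 : 0 < M by rewrite ME mulr_gt0// exprn_gt0.
have L0 : 0 < L by apply: lt_le_trans LB; rewrite exprn_gt0.
have s0 : 0 < s by rewrite sE !mulr_gt0.
have E0 : 0 < E by rewrite EE expR_gt0.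
have B2 : 1 <= B ^+ 2 by exact: exprn_ege1.
have [th_lt1 th_gtN1 P0 PE thP] := shock_bounds E0 thE PdE.
(* The size [16 * B ^+ 3] of [M] is made for this: with [A >= 1 / B], the slope term [mu * (M * A)]
   exceeds several times every error of order [B ^+ 2 * mu]. *)
have MA : 16 * B ^+ 2 <= M * A.
  rewrite (_ : M * A = 16 * B ^+ 2 * (A * B)); last by rewrite ME; ring.
  by rewrite ler_peMr// mulr_ge0// exprn_ge0// ltW.
have qM : `|q| <= M.
  have qB : `|q| <= B ^+ 2.
    rewrite -(ler_pM2l A0) -{1}(gtr0_norm A0) -normrM -dAE (le_trans dAB)//.
    by rewrite expr2 mulrA ler_peMl// ltW.
  apply: (le_trans qB); rewrite ME.
  have h1 : B ^+ 2 * 1 <= B ^+ 2 * B by rewrite ler_pM2l// exprn_gt0.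
  by rewrite (exprSr _ 2); move: h1 B2; clear; lra.
have smu : s / mu = 16 * B * L.
  by rewrite sE; field; rewrite gt_eqF.
have AAF : 16 * L <= A ^+ 2 * F * (s / mu) * B ^+ 2.
  rewrite smu (_ : _ * B ^+ 2 = 16 * L * ((A * B) * (A * B) * (F * B))).
    have h : 1 <= A * B * (A * B) * (F * B) by do 2?[apply: mulr_ege1 => //].
    by rewrite ler_peMr// mulr_ge0// ltW.
  by ring.
(* Half of the gain [F * s] due to the shift pays for the offset [c] and for the drift [mu * dX];
   the lower bound on [8 * L] is what this takes. *)
have Fs_ge : 2 * (c + mu * B) <= F * s.
  rewrite sE (_ : F * _ = 16 * L * mu * (F * B)); last by ring.
  apply: (@le_trans _ _ (16 * L * mu)); last first.
    by rewrite ler_peMr// !mulr_ge0// ltW.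
  have h := ler_pM2l mu0 (2 * M + C0 + 1 + B) (8 * L).
  by move: h; rewrite LC cE; clear; lra.
have c0 : 0 <= c.
  by rewrite cE mulr_ge0 ?(ltW mu0)//; move: C00 M0; clear; lra.
have gB : `|g| <= 2 * B ^+ 2.
  rewrite gE (le_trans (ler_normB _ _))// !normrM (gtr0_norm F0).
  have h1 : `|dF| * `|y + s| <= B * 1 by rewrite ler_pM.
  have h2 : F * `|dX| <= B * B by rewrite ler_pM// ltW.
  have h3 : B * 1 <= B * B by rewrite ler_pM2l.
  by rewrite expr2; move: h1 h2 h3; clear; lra.
have dAth : `|dA * th| <= B ^+ 2.
  rewrite normrM expr2 ler_pM// (@le_trans _ _ 1)//.
  by rewrite ler_norml (ltW th_lt1) ltW.
have MdX : `|mu * M * dX| <= 1.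
  rewrite normrM gtr0_norm ?mulr_gt0// (le_trans _ muM)// ler_pM2l//.
  by rewrite mulr_gt0.
set lhs := (X in mu * g < X).
(* The time derivative acting on the argument of the shock is also proportional to [P]. Writing
   [dA = A * q] lets it join the transport term, and [br] is their common cofactor of
   [A ^+ 2 * P / mu]. *)
pose br := sg * (mu * M * y) - c + F * (y + s) - mu * (q * y) + mu * dX.
have lhsE : lhs = A ^+ 2 * P / mu * br
    + sg * (mu * M) * (A * th + sg * (mu * M * y) - c + F * (y + s))
    - mu * (dA * th - sg * (mu * M * dX)).
  by rewrite /lhs /br dAE; field; rewrite gt_eqF.
(* The terms without the factor [P], right-hand side included, amount to at most
   [4 * B ^+ 2 * mu]. *)
have slack : - (4 * B ^+ 2 * mu) <= - (mu * (dA * th - sg * (mu * M * dX))) - mu * g.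
  rewrite -opprD lerN2 -mulrDr [leRHS]mulrC ler_pM2l//.
  have sgdX : - (sg * (mu * M * dX)) <= 1.
    by case: sgy => -[-> _]; move: MdX; rewrite ler_norml; clear; lra.
  by move: dAth gB B2 sgdX; rewrite !ler_norml; clear; lra.
have Wp0 : 0 < A ^+ 2 * P / mu by rewrite divr_gt0// mulr_gt0// exprn_gt0.
pose W := A ^+ 2 * F * (s / mu).
have B2mu0 : 0 < B ^+ 2 * mu by rewrite mulr_gt0// exprn_gt0.
have key : 128 * B ^+ 2 * mu <= W.
  have h : 16 <= W.
    rewrite -(@ler_pM2r _ (B ^+ 2)) ?exprn_gt0//.
    by apply: le_trans AAF; rewrite ler_pM2l.
  by move: h muB; clear; lra.
have W0 : 0 < W by apply: lt_le_trans key; rewrite -mulrA mulr_gt0.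
have qMy : mu * `|q * y| <= mu * M * `|y|.
  by rewrite normrM -[leRHS]mulrA ler_pM2l// ler_wpM2r.
have WE : A ^+ 2 * P / mu * (F * s) = P * W by rewrite /W; ring.
have mudX : mu * dX >= - (mu * B).
  by rewrite -mulrN ler_pM2l//; move: dXB; rewrite ler_norml => /andP[].
have qyy : mu * (q * y) <= mu * M * `|y|.
  by apply: le_trans qMy; rewrite ler_pM2l// ler_norm.
have thP' : (1 - `|th|) * W <= 2 * (P * W) by rewrite mulrA ler_pM2r.
have thle1 : `|th| <= 1 by rewrite ler_norml !ltW.
have MAmu : 16 * B ^+ 2 * mu <= mu * (M * A) by rewrite [leRHS]mulrC ler_pM2r.
rewrite -subr_gt0 lhsE.
have [[sg1 y0]|[sg1 y0]] := sgy.
- rewrite (ger0_norm y0) in qyy.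
  have E1 : 1 <= E by rewrite EE -expR0 ler_expR divr_ge0 ?(ltW mu0)// mulr_ge0 ?(ltW A0).
  have th0 : 0 <= th by rewrite thE subr_ge0 ler_pdivrMr ?addr_gt0//; move: E1; clear; lra.
  have Fy : 0 <= F * y by rewrite mulr_ge0 ?(ltW F0).
  have br_ge : F * s / 2 <= br.
    by rewrite /br sg1; move: Fy qyy mudX Fs_ge; clear; lra.
  have h1 : P * W / 2 <= A ^+ 2 * P / mu * br.
    by rewrite -WE -mulrA ler_pM2l.
  have h2 : 0 <= mu * M * (mu * M * y - c + F * (y + s)).
    rewrite mulr_ge0 ?mulr_ge0 ?ltW//.
    have k1 : 0 <= mu * M * y by rewrite !mulr_ge0 ?(ltW mu0) ?(ltW M0).
    have k2 : 0 < mu * B by rewrite mulr_gt0.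
    by move: k1 k2 Fs_ge c0 Fy; clear; lra.
  rewrite (ger0_norm th0) in thP' thle1.
  (* By [shock_bounds] the transport gain has weight at least of order [1 - |th|], while the slope
     gain has weight [|th|]. Both gains exceed the error, hence so does their convex combination,
     wherever the point lies in the layer. *)
  have := @convex_ge _ th (W / 4) (mu * (M * A)) (16 * B ^+ 2 * mu) th0 thle1.
  rewrite sg1 in slack *; move: h1 h2 key MAmu slack thP' B2mu0; clear.
  move=> h1 h2 key MAmu slack thP' B2mu0 h.
  have {}h := h _ MAmu.
  have {}h : 16 * B ^+ 2 * mu <= (1 - th) * (W / 4) + th * (mu * (M * A)).
    by apply: h; lra.
  lra.
- rewrite (ler0_norm y0) in qyy.
  have E1 : E <= 1.
    by rewrite EE -expR0 ler_expR mulr_le0_ge0 ?invr_ge0 ?(ltW mu0)// mulr_ge0_le0 ?(ltW A0).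
  have th0 : th <= 0.
    by rewrite thE subr_le0 ler_pdivlMr ?addr_gt0//; move: E1; clear; lra.
  have br_ge : F * s / 2 + F * y <= br.
    by rewrite /br sg1; move: qyy mudX Fs_ge; clear; lra.
  have y2 : - y <= 2 by move: ys1 s1; rewrite ler_norml; clear; lra.
  have h2 : mu * (M * A) * - th - mu <=
      - 1 * (mu * M) * (A * th + - 1 * (mu * M * y) - c + F * (y + s)).
    have k1 : mu * M * - y <= mu * M * 2 by rewrite ler_pM2l ?mulr_gt0.
    have k2 : F * s <= B * s by rewrite ler_pM2r.
    have k3 : F * y <= 0 by rewrite mulr_ge0_le0 ?(ltW F0).
    have k4 : M * (mu * M * - y - c + F * (y + s)) <= 1.
      apply: le_trans Ms; rewrite ler_pM2l//; move: k1 k2 k3 c0; clear; lra.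
    have := k4; rewrite -(ler_pM2l mu0); clear; lra.
  rewrite (ler0_norm th0) in thP' thle1.
  have mth0 : 0 <= - th by rewrite oppr_ge0.
  have mu8 : mu * 8 <= 1.
    by apply: le_trans muB; rewrite ler_pM2l// ler_peMr.
  have muB2 : mu <= B ^+ 2 * mu by rewrite ler_peMl// ltW.
  have [ys|ys] := lerP (- y) (s / 4).
    have br_ge' : F * s / 4 <= br.
      have : F * - y <= F * (s / 4) by rewrite ler_pM2l.
      by move: br_ge; clear; lra.
    have h1 : P * W / 4 <= A ^+ 2 * P / mu * br by rewrite -WE -mulrA ler_pM2l.
    have := @convex_ge _ (- th) (W / 8) (mu * (M * A)) (16 * B ^+ 2 * mu) mth0 thle1.
    rewrite sg1 in slack *; move: h1 h2 key MAmu slack thP' muB2 mu0; clear.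
    move=> h1 h2 key MAmu slack thP' muB2 mu0 h.
    have {}h : 16 * B ^+ 2 * mu <= (1 - - th) * (W / 8) + - th * (mu * (M * A)).
      by apply: h => //; lra.
    lra.
  pose z := A * - y / mu.
  (* Beyond [s / 4], the choice [s = 16 * B * (mu * L)] makes the exponent [z] at least [4 * L].
     Half of it yields [mu ^+ 2], and the other half absorbs the factor [z] brought by the transport
     term. *)
  have z4 : 2 * L <= z / 2.
    have : 2 * L <= 2 * L * (A * B) by rewrite ler_peMr// mulr_ge0 ?(ltW L0).
    have : A * (s / 4) / mu <= z.
      by rewrite /z ler_pM2r ?invr_gt0// ler_pM2l// ltW.
    rewrite (_ : A * _ / _ = 4 * L * (A * B)); last first.
      by rewrite sE; field; rewrite gt_eqF.
    by clear; lra.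
  have ez : expR (- (z / 2)) <= mu ^+ 2.
    by apply: le_trans mu_expR; rewrite ler_expR lerN2.
  have EzE : E = expR (- z) by rewrite EE /z mulrN mulNr opprK.
  have mu2 : mu ^+ 2 <= mu / 8.
    rewrite expr2 ler_pM2l//; move: mu8; clear; lra.
  have Ele : E <= 1 / 3.
    have : E <= expR (- (z / 2)).
      by rewrite EzE ler_expR lerN2; move: z4 L0; clear; lra.
    by move: ez mu2 mu8; clear; lra.
  have thh : 1 / 2 <= - th.
    have : 3 / 2 <= 2 / (1 + E).
      by rewrite ler_pdivlMr ?addr_gt0//; move: Ele; clear; lra.
    by rewrite thE; clear; lra.
  have h1 : - (B ^+ 2 * mu) <= A ^+ 2 * P / mu * br.
    have k0 : A ^+ 2 * P / mu * (F * y) <= A ^+ 2 * P / mu * br.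
      rewrite ler_pM2l//; apply: le_trans br_ge.
      by rewrite lerDr divr_ge0// mulr_ge0// ltW.
    apply: le_trans k0.
    have -> : A ^+ 2 * P / mu * (F * y) = - (A * F * z * P) by rewrite /z; ring.
    rewrite lerN2.
    have AF : A * F <= B ^+ 2 by rewrite expr2 ler_pM// ltW.
    have z0 : 0 < z by move: z4 L0; clear; lra.
    have k1 : A * F * z * P <= B ^+ 2 * z * (2 * E).
      have AFz : A * F * z <= B ^+ 2 * z by rewrite ler_pM2r.
      have AFz0 : 0 <= A * F * z.
        by apply/ltW/mulr_gt0 => //; exact: mulr_gt0.
      by rewrite ler_pM// ltW.
    apply: (le_trans k1).
    have k2 : B ^+ 2 * (z * E) <= B ^+ 2 * (mu / 4).
      rewrite ler_pM2l ?exprn_gt0// EzE (le_trans (mul_expRN_le z))//.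
      by move: ez mu2; clear; lra.
    by move: k2 B2mu0; clear; lra.
  have h3 : mu * (M * A) * (1 / 2) <= mu * (M * A) * - th.
    by rewrite ler_pM2l// mulr_gt0// mulr_gt0.
  rewrite sg1 in slack *; move: h1 h2 h3 MAmu slack muB2 mu0; clear; lra.
Qed.

(** * Derivatives of the shock and of the barrier *)

Lemma is_derive_shock (R : realType) (z : R) :
  is_derive z 1 (@shock R) ((1 - shock z ^+ 2) / 2).
Proof.
have h : 1 + expR z != 0 by rewrite gt_eqF// addr_gt0// expR_gt0.
have dE : is_derive z 1 (fun u : R => 1 + expR u) (expR z).
  by rewrite -[X in is_derive _ _ _ X]add0r; exact: is_deriveD.
have dV : is_derive z 1 (fun u : R => (1 + expR u)^-1) (- (1 + expR z) ^- 2 *: expR z).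
  exact: is_deriveV.
have dS : is_derive z 1 (cst 1 - (2 : R) *: (fun u : R => (1 + expR u)^-1) : R -> R)
    (0 - 2 *: (- (1 + expR z) ^- 2 *: expR z)).
  exact: is_deriveB.
rewrite (_ : (1 - _) / 2 = 0 - 2 *: (- (1 + expR z) ^- 2 *: expR z)).
  exact: dS.
by rewrite /shock /GRing.scale/=; field.
Qed.

Lemma is_derive_shock_comp (R : realType) (g : R -> R) (x dg : R) :
  is_derive x 1 g dg ->
  is_derive x 1 (fun u => shock (g u)) ((1 - shock (g x) ^+ 2) / 2 * dg).
Proof. by move=> h; apply: is_derive1_comp; exact: is_derive_shock. Qed.

Lemma is_derive_eqP (R : realType) (f g : R -> R) (x d d' : R) :
  is_derive x 1 f d -> f =1 g -> d = d' -> is_derive x 1 g d'.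
Proof. by move=> h /funext <- <-. Qed.

Lemma is_derive_affine (R : realType) (a b x : R) :
  is_derive x 1 (fun u : R => a * (u - b)) a.
Proof.
have h : is_derive x 1 (a *: (@id R - cst b) : R -> R) (a *: (1 - 0)).
  by apply: is_deriveZ; apply: is_deriveB.
apply: is_derive_eqP h _ _ => //.
by rewrite subr0 /GRing.scale/= mulr1.
Qed.

(* Used with [sg = 1] and [sg = -1]: the maximum of the two has a convex kink, which
   is harmless for a subsolution. *)
Definition barrier (R : realType) (mu M c s sg : R) (A X : R -> R) (x t : R) : R :=
  A t * shock (A t / mu * (x - (X t + s))) + sg * (mu * M) * (x - (X t + s)) - c.

Definition barrier_dx (R : realType) (mu M s sg : R) (A X : R -> R) (x t : R) : R :=
  A t * ((1 - shock (A t / mu * (x - (X t + s))) ^+ 2) / 2 * (A t / mu))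
  + sg * (mu * M).

Lemma is_derive_barrier_x (R : realType) (mu M c s sg : R) (A X : R -> R) (x t : R) :
  is_derive x 1 (fun u => barrier mu M c s sg A X u t)
    (barrier_dx mu M s sg A X x t).
Proof.
pose h := fun u : R => shock (A t / mu * (u - (X t + s))).
have dh : is_derive x 1 h ((1 - h x ^+ 2) / 2 * (A t / mu)).
  by apply: is_derive_shock_comp; exact: is_derive_affine.
have dl := is_derive_affine (sg * (mu * M)) (X t + s) x.
have d : is_derive x 1 (A t *: h + (fun u => sg * (mu * M) * (u - (X t + s))) - cst c)
    (A t *: ((1 - h x ^+ 2) / 2 * (A t / mu)) + sg * (mu * M) - 0).
  exact: is_deriveB.
by apply: is_derive_eqP d _ _ => //; rewrite subr0.
Qed.

Lemma is_derive_barrier_xx (R : realType) (mu M s sg : R) (A X : R -> R) (x t : R) :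
  let th := shock (A t / mu * (x - (X t + s))) in
  is_derive x 1 (fun u => barrier_dx mu M s sg A X u t)
    (- (A t ^+ 3 / mu ^+ 2 * th * ((1 - th ^+ 2) / 2))).
Proof.
pose h := fun u : R => shock (A t / mu * (u - (X t + s))).
have dh : is_derive x 1 h ((1 - h x ^+ 2) / 2 * (A t / mu)).
  by apply: is_derive_shock_comp; exact: is_derive_affine.
move=> th.
have d : is_derive x 1 ((A t * (A t / mu) / 2) *: (cst 1 - h * h)
    + cst (sg * (mu * M)) : R -> R)
    ((A t * (A t / mu) / 2) *: (0 - (h x *: ((1 - h x ^+ 2) / 2 * (A t / mu)) +
      h x *: ((1 - h x ^+ 2) / 2 * (A t / mu)))) + 0).
  apply: is_deriveD; apply: is_deriveZ; apply: is_deriveB; exact: is_deriveM.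
apply: is_derive_eqP d _ _ => [u|].
  rewrite /barrier_dx -/(h u).
  transitivity (A t * (A t / mu) / 2 * (1 - h u * h u) + sg * (mu * M)) => //.
  by rewrite expr2; ring.
pose P : R := (1 - th ^+ 2) / 2.
transitivity (A t * (A t / mu) / 2 *
  (0 - (th * (P * (A t / mu)) + th * (P * (A t / mu)))) + 0 : R) => //.
by rewrite -/P -exprVn; move: (mu^-1) P => b P; field.
Qed.

Lemma is_derive_barrier_t (R : realType) (mu M c s sg : R) (A X : R -> R)
    (x t dA dX : R) :
  is_derive t 1 A dA -> is_derive t 1 X dX ->
  let y := x - (X t + s) in
  let th := shock (A t / mu * y) in
  is_derive t 1 (barrier mu M c s sg A X x)
    (dA * th + A t * ((1 - th ^+ 2) / 2) * (dA * y - A t * dX) / mu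
     - sg * (mu * M * dX)).
Proof.
move=> hA hX y th.
pose Y : R -> R := cst x - (X + cst s).
have dY : is_derive t 1 Y (0 - (dX + 0)).
  by apply: is_deriveB; exact: is_deriveD.
have dG : is_derive t 1 (mu^-1 *: (A * Y) : R -> R)
    (mu^-1 *: (A t *: (0 - (dX + 0)) + Y t *: dA)).
  by apply: is_deriveZ; exact: is_deriveM.
have dS := is_derive_shock_comp dG.
set h := (fun u => shock _) in dS.
have d : is_derive t 1 (A * h + (sg * (mu * M)) *: Y - cst c : R -> R)
    (A t *: ((1 - shock ((mu^-1 *: (A * Y) : R -> R) t) ^+ 2) / 2 *
      (mu^-1 *: (A t *: (0 - (dX + 0)) + Y t *: dA))) + h t *: dA
     + (sg * (mu * M)) *: (0 - (dX + 0)) - 0).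
  by apply: is_deriveB.
have gE u : (mu^-1 *: (A * Y) : R -> R) u = A u / mu * (x - (X u + s)).
  transitivity (mu^-1 * (A u * (x - (X u + s)))) => //.
  by ring.
have hE u : h u = shock (A u / mu * (x - (X u + s))).
  by rewrite /h gE.
apply: is_derive_eqP d _ _ => [u|].
  by rewrite /barrier -hE.
rewrite gE -/y -/th hE -/y -/th (_ : Y t = y)//.
pose P : R := (1 - th ^+ 2) / 2.
transitivity (A t * (P * (mu^-1 * (A t * (0 - (dX + 0)) + y * dA))) + th * dA
  + sg * (mu * M) * (0 - (dX + 0)) - 0 : R) => //.
by rewrite -/P; ring.
Qed.

(* Problem satisfied by [u - F(t) (x - X(t))], the deviation of [u] from the mean of
   the two outer solutions, which makes the layer a symmetric jump. *)
Definition layer_solution (R : realType) (T mu : R) (F dF X dX : R -> R)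
    (v : R -> R -> R) : Prop :=
  {within `[0, 1] `*` `[0, T], continuous (fun p : R * R => v p.1 p.2)} /\
  exists vx vxx vt : R -> R -> R, forall x t : R, 0 < x < 1 -> 0 < t <= T ->
    [/\ is_derive x 1 (v^~ t) (vx x t), is_derive x 1 (vx^~ t) (vxx x t),
        is_derive t 1 (v x) (vt x t) &
        mu * (vxx x t - vt x t) + (v x t + F t * (x - X t)) * vx x t =
        mu * (dF t * (x - X t) - F t * dX t)].

(** At the contact point [v - b] has a minimum in [x] and a nonpositive time derivative, which
    orders [vxx] and [vt] against [bxx] and [bt]. Values and slopes agree, so the transport terms
    are equal. A barrier with a strict residual therefore cannot touch. *)
Lemma layer_touching (R : realType) (T mu : R) (F dF X dX : R -> R)
    (v b : R -> R -> R) (bx : R -> R) (bxx bt x t : R) :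
  0 < mu -> layer_solution T mu F dF X dX v ->
  0 < x < 1 -> 0 < t <= T ->
  (forall y : R, is_derive y 1 (b^~ t) (bx y)) -> is_derive x 1 bx bxx ->
  is_derive t 1 (b x) bt ->
  b x t = v x t ->
  (forall y : R, 0 <= y <= 1 -> b y t <= v y t) ->
  (forall s : R, 0 <= s <= t -> b x s <= v x s) ->
  mu * (bxx - bt) + (b x t + F t * (x - X t)) * bx x <=
  mu * (dF t * (x - X t) - F t * dX t).
Proof.
move=> mu0 [_ [vx [vxx [vt hv]]]] x01 t0T hbx hbxx hbt bv byt bxs.
have [dvx dvxx dvt <-] := hv _ _ x01 t0T.
have [] := @second_derivative_test R ((v^~ t) - (b^~ t)) ((vx^~ t) - bx) x (vxx x t - bxx) x01.
- by move=> y y01; have [? _ _ _] := hv _ _ y01 t0T; exact: is_deriveB.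
- move=> y y01; change (v x t - b x t <= v y t - b y t).
  by rewrite bv subrr subr_ge0 byt.
change (vx x t - bx x = 0 -> 0 <= vxx x t - bxx ->
  mu * (bxx - bt) + (b x t + F t * (x - X t)) * bx x <=
  mu * (vxx x t - vt x t) + (v x t + F t * (x - X t)) * vx x t).
move=> /subr0_eq -> hxx.
have ht : vt x t - bt <= 0.
  case/andP: t0T => t0 _.
  apply: (@derive_left_le0 R ((v x) - (b x)) t) => //.
  - by change (v x t - b x t = 0); rewrite bv subrr.
  - by move=> s st; change (0 <= v x s - b x s); rewrite subr_ge0 bxs.
rewrite bv lerD2r ler_pM2l//; lra.
Qed.

Lemma shock_le (R : realType) : {homo @shock R : x y / x <= y}.
Proof.
move=> x y xy; rewrite /shock lerD2l lerN2 ler_pM2l//.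
by rewrite lef_pV2 ?posrE ?addr_gt0 ?expR_gt0// lerD2l ler_expR.
Qed.

Lemma shock_lt1 (R : realType) (x : R) : shock x < 1.
Proof. by rewrite /shock ltrBlDr ltrDl divr_gt0// addr_gt0// expR_gt0. Qed.

Lemma shock_leN (R : realType) (x : R) : shock x <= -1 + 2 * expR x.
Proof.
have e0 := expR_gt0 x.
rewrite /shock lerBlDr -lerBlDl ler_pdivlMr ?addr_gt0//.
have := sqr_ge0 (expR x); lra.
Qed.

Lemma shock_ge (R : realType) (x : R) : 1 <= x -> 1 / 3 <= shock x.
Proof.
move=> x1; rewrite /shock lerBrDr -lerBrDl ler_pdivrMr ?addr_gt0 ?expR_gt0//.
have := expR_ge1Dx x; lra.
Qed.

Lemma continuous_barrier (R : realType) (mu M c s sg : R) (A X : R -> R) :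
  continuous A -> continuous X ->
  continuous (fun p : R * R => barrier mu M c s sg A X p.1 p.2).
Proof.
move=> cA cX p.
have cA2 : (fun q : R * R => A q.2) @ p --> A p.2.
  by apply: (@continuous_comp _ _ _ snd A); [exact: cvg_snd|exact: cA].
have cy : (fun q : R * R => q.1 - (X q.2 + s)) @ p --> p.1 - (X p.2 + s).
  apply: cvgB; first exact: cvg_fst.
  apply: cvgD; last exact: cvg_cst.
  by apply: (@continuous_comp _ _ _ snd X); [exact: cvg_snd|exact: cX].
have cshock : continuous (@shock R).
  move=> z; apply/differentiable_continuous/derivable1_diffP.
  exact: (@ex_derive _ _ _ _ _ _ _ (is_derive_shock z)).
have cS : (fun q : R * R => shock (A q.2 / mu * (q.1 - (X q.2 + s)))) @ p -->
    shock (A p.2 / mu * (p.1 - (X p.2 + s))).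
  apply: (@cvg_comp _ _ _ _ (@shock R) _ _ _ _ (cshock _)).
  by apply: cvgM => //; apply: cvgM => //; exact: cvg_cst.
apply: cvgB; last exact: cvg_cst.
by apply: cvgD; [exact: cvgM|apply: cvgM => //; exact: cvg_cst].
Qed.

(** A single [B] serves for all upper bounds and, as [1 <= A t * B], for the positive lower bounds,
    so that the thresholds on [mu] depend on one number. *)
Definition layer_coefficients (R : realType) (T B : R) (F dF X dX A dA : R -> R) :=
  [/\ forall t : R, is_derive t 1 X (dX t), forall t : R, is_derive t 1 A (dA t) &
      forall t : R, 0 <= t <= T ->
        [/\ 0 <= X t <= 1, 1 <= A t * B /\ A t <= B, 1 <= F t * B /\ F t <= B,
            `|dA t| <= B /\ `|dF t| <= B & `|dX t| <= B]].

(** Only lower bounds, as needed to start and keep a barrier below [v]; the reflected problem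
    provides the other side. *)
Definition layer_data (R : realType) (T mu C0 : R) (X A : R -> R)
    (v : R -> R -> R) :=
  [/\ forall t : R, 0 <= t <= T -> - A t <= v 0 t,
      forall t : R, 0 <= t <= T -> A t <= v 1 t &
      forall x : R, 0 <= x <= 1 ->
        A 0 * shock (A 0 / mu * (x - X 0)) - C0 * mu <= v x 0].

(** First touching is applied to [v] minus the maximum of the two barriers. At a contact, the branch
    that attains the maximum is itself below [v] everywhere and touches it there, which its strict
    residual forbids. *)
Lemma barrier_below (R : realType) (T B C0 mu L M c s : R)
    (F dF X dX A dA : R -> R) (v : R -> R -> R) :
  M = 16 * B ^+ 3 -> c = mu * (2 * M + C0 + 1) -> s = 16 * B * (mu * L) ->
  0 < T -> 1 <= B -> 0 <= C0 -> 0 < mu -> s <= 1 ->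
  B ^+ 2 <= L -> 2 * M + C0 + 1 + B <= 8 * L ->
  mu * (8 * B ^+ 2) <= 1 -> mu * M * B <= 1 ->
  M * (2 * (mu * M) + B * s) <= 1 ->
  expR (- (2 * L)) <= mu ^+ 2 ->
  layer_coefficients T B F dF X dX A dA ->
  layer_solution T mu F dF X dX v ->
  layer_data T mu C0 X A v ->
  forall x t sg : R, 0 <= x <= 1 -> 0 <= t <= T -> sg = 1 \/ sg = -1 ->
    barrier mu M c s sg A X x t < v x t.
Proof.
move=> ME cE sE T0 B1 C00 mu0 s1 LB LC muB muM Ms mu_expR [dXP dAP bnd] vsol [v0 v1 vi].
have B0 : 0 < B by exact: lt_le_trans B1.
have M0 : 0 < M by rewrite ME mulr_gt0// exprn_gt0.
have L0 : 0 < L by apply: lt_le_trans LB; rewrite exprn_gt0.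
have s0 : 0 < s by rewrite sE !mulr_gt0.
have contA : continuous A.
  by move=> t; apply/differentiable_continuous/derivable1_diffP; case: (dAP t).
have contX : continuous X.
  by move=> t; apply/differentiable_continuous/derivable1_diffP; case: (dXP t).
pose b sg := barrier mu M c s sg A X.
pose z x t := v x t - Num.max (b 1 x t) (b (-1) x t).
have slope (x t : R) : 0 <= x <= 1 -> 0 <= t <= T ->
    `|mu * M * (x - (X t + s))| <= mu * M * 2.
  move=> x01 t0T; rewrite normrM gtr0_norm ?mulr_gt0// ler_pM2l ?mulr_gt0//.
  have [X01 _ _ _ _] := bnd t t0T.
  by move: x01 X01 s0 s1; rewrite ler_norml; clear; lra.
(* The slope correction is at most [2 * mu * M], which is part of [c]. The rest, [mu * (C0 + 1)], is
   left for the initial error and for strictness. *)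
have zgt (sg x t : R) : sg = 1 \/ sg = -1 -> 0 <= x <= 1 -> 0 <= t <= T ->
  A t * shock (A t / mu * (x - (X t + s))) < v x t + mu * (C0 + 1) ->
  b sg x t < v x t.
  move=> sg1 x01 t0T h; rewrite /b /barrier.
  have := slope x t x01 t0T; rewrite ler_norml => /andP[h1 h2].
  by case: sg1 => ->; move: h h1 h2; rewrite cE; clear; lra.
have maxlt (x t : R) : (forall sg : R, sg = 1 \/ sg = -1 -> b sg x t < v x t) -> 0 < z x t.
  by move=> h; rewrite subr_gt0 gt_max !h//; [right|left].
have muC : 0 < mu * (C0 + 1) by rewrite mulr_gt0// ltr_wpDl.
have A_gt0 (t : R) : 0 <= t <= T -> 0 < A t.
  move=> /bnd[_ [h _] _ _ _]; rewrite -(pmulr_lgt0 _ B0).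
  exact: lt_le_trans h.
suff zpos (x t : R) : 0 <= x <= 1 -> 0 <= t <= T -> 0 < z x t.
  move=> x t sg x01 t0T sg1; have := zpos x t x01 t0T.
  rewrite subr_gt0 gt_max => /andP[h1 h2].
  by case: sg1 => ->.
apply: first_touching => {x t}.
- have [cv _] := vsol.
  pose w := (fun p : R * R => b 1 p.1 p.2) \max (fun p : R * R => b (-1) p.1 p.2).
  have cw : {within `[0, 1] `*` `[0, T], continuous w}.
    apply: continuous_subspaceT => q.
    by apply: continuous_max; exact: continuous_barrier.
  by move=> p; exact: (continuousB (cv p) (cw p)).
- move=> x x01; apply: maxlt => sg sg1.
  have T00 : (0 : R) <= 0 <= T by rewrite lexx ltW.
  apply: zgt => //; have h0 := vi x x01.
  have : A 0 * shock (A 0 / mu * (x - (X 0 + s))) <=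
      A 0 * shock (A 0 / mu * (x - X 0)).
    rewrite ler_pM2l ?A_gt0//; apply: shock_le.
    by rewrite ler_pM2l ?divr_gt0 ?A_gt0//; move: s0; clear; lra.
  by move: h0 mu0; clear; lra.
- move=> t t0T; split.
    apply: maxlt => sg sg1; apply: zgt => //; first by rewrite lexx ler01.
    apply: lt_le_trans (lerD (v0 t t0T) (lexx _)).
    have [X01 [AB1 AB] _ _ _] := bnd t t0T.
    (* At [x = 0] the shift alone brings the shock within [O(mu^2)] of its left limit [- A t], even
       when [X t] is at the boundary. *)
    apply: le_lt_trans (_ : A t * (-1 + 2 * expR (- (2 * L))) < _).
      rewrite ler_pM2l ?A_gt0//; apply: le_trans (shock_leN _) _.
      rewrite lerD2l ler_pM2l// ler_expR sub0r mulrN lerN2.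
      apply: (@le_trans _ _ (A t / mu * s)); last first.
        rewrite ler_pM2l ?divr_gt0 ?A_gt0//.
        by move: X01; clear; lra.
      rewrite (_ : _ * s = 16 * L * (A t * B)); last first.
        by rewrite sE; field; rewrite gt_eqF.
      have : L <= L * (A t * B) by rewrite ler_peMr// ltW.
      by move: L0; clear; lra.
    have h1 : A t * expR (- (2 * L)) <= B * mu ^+ 2.
      by rewrite ler_pM ?expR_ge0 ?(ltW (A_gt0 _ t0T)).
    have h2 : B * mu ^+ 2 * 8 <= mu.
      have : B * mu * 8 <= 1.
        have hB : mu * B <= mu * B ^+ 2.
          by rewrite ler_pM2l// expr2 ler_peMr// ltW.
        by move: muB hB; clear; lra.
      by rewrite -(ler_pM2l mu0) expr2; clear; lra.
    have h3 : 0 <= mu * C0 by rewrite mulr_ge0// ltW.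
    by move: h1 h2 h3 mu0; clear; lra.
  apply: maxlt => sg sg1; apply: zgt => //; first by rewrite ler01 lexx.
  apply: lt_le_trans (lerD (v1 t t0T) (lexx _)).
  have := ltr_pM2l (A_gt0 _ t0T) (shock (A t / mu * (1 - (X t + s)))) 1.
  by rewrite shock_lt1; move: muC; clear; lra.
- move=> x t x01 t0T zx0 zy zs.
  have t0T' : 0 <= t <= T by case/andP: t0T => /ltW ->.
  have [X01 [AB1 AB] [FB1 FB] [dAB dFB] dXB] := bnd t t0T'.
  pose y := x - (X t + s).
  (* The branches differ by [2 * (mu * M) * y], so the sign of [y] selects the one attaining the
     maximum, and this is the side on which the residual estimate holds for it. *)
  have [sg [sgE sgv]] : exists sg : R, (sg = 1 /\ 0 <= y \/ sg = -1 /\ y <= 0) /\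
      b sg x t = v x t.
    have /eqP := zx0; rewrite subr_eq0 => /eqP ->.
    have mM : 0 < mu * M by rewrite mulr_gt0.
    have bB : b 1 x t - b (-1) x t = 2 * (mu * M) * y by rewrite /b /barrier -/y; ring.
    have [y0|/ltW y0] := leP 0 y.
      exists 1; split; [by left|rewrite max_l// -subr_ge0 bB].
      by rewrite !mulr_ge0// ltW.
    exists (-1); split; [by right|rewrite max_r// -subr_le0 bB].
    by rewrite mulr_ge0_le0// mulr_ge0// ltW.
  have ble x' t' : b sg x' t' <= Num.max (b 1 x' t') (b (-1) x' t').
    by case: sgE => -[-> _]; rewrite le_max lexx ?orbT.
  have ht := @layer_touching R T mu F dF X dX v (b sg) _ _ _ x t mu0 vsol x01 t0T
    (fun u => is_derive_barrier_x mu M c s sg A X u t)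
    (is_derive_barrier_xx mu M s sg A X x t)
    (is_derive_barrier_t mu M c s sg x (dAP t) (dXP t)) sgv.
  have bvy u : 0 <= u <= 1 -> b sg u t <= v u t.
    by move=> /zy; rewrite subr_ge0; exact: le_trans (ble _ _).
  have bvs u : 0 <= u <= t -> b sg x u <= v x u.
    by move=> /zs; rewrite subr_ge0; exact: le_trans (ble _ _).
  have {}ht := ht bvy bvs.
  have ysE : y + s = x - X t by rewrite /y; ring.
  pose th := shock (A t / mu * y).
  have thE : th = 1 - 2 / (1 + expR (A t * y / mu)) by rewrite /th /shock mulrAC.
  have dAE : dA t = A t * (dA t / A t) by rewrite mulrC divfK// gt_eqF// A_gt0.
  have ys1 : `|y + s| <= 1.
    by rewrite ysE ler_norml; move: x01 X01; clear; lra.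
  have hr := barrier_residual_gt0 ME cE sE erefl thE erefl dAE erefl B1 C00 mu0
    AB1 AB FB1 FB dAB dFB dXB ys1 s1 LB LC muB muM Ms mu_expR sgE.
  have {ht} : mu * (dF t * (y + s) - F t * dX t) < mu * (dF t * (y + s) - F t * dX t).
    apply: (lt_le_trans hr); rewrite ysE.
    apply: le_trans ht.
    rewrite /b /barrier /barrier_dx -/y -/th.
    clear hr thE; clearbody th y.
    rewrite le_eqVlt; apply/orP; left; apply/eqP.
    by field; rewrite gt_eqF.
  by rewrite ltxx.
Qed.

(** * Position of the zeros of [v] *)

Lemma shockN (R : realType) (z : R) : shock (- z) = - shock z.
Proof.
rewrite /shock expRN; field.
have e0 := expR_gt0 z.
by rewrite !gt_eqF// addr_gt0.
Qed.

(* In terms of [L = - ln mu], [mu = expR (- L)] and [mu * L <= 4 / L], so all the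
   smallness conditions reduce to [L] being large. *)
Lemma layer_right_bound (R : realType) (T B C0 : R) :
  0 < T -> 1 <= B -> 0 <= C0 ->
  exists K mu1 : R, [/\ 0 < K, 0 < mu1 & mu1 < 1] /\
  forall (mu : R) (F dF X dX A dA : R -> R) (v : R -> R -> R), 0 < mu <= mu1 ->
    layer_coefficients T B F dF X dX A dA ->
    layer_solution T mu F dF X dX v ->
    layer_data T mu C0 X A v ->
    forall x t : R, 0 <= x <= 1 -> 0 <= t <= T ->
      v x t = 0 -> x <= X t + K * (mu * `|ln mu|).
Proof.
move=> T0 B1 C00.
have B0 : 0 < B by exact: lt_le_trans B1.
pose M := 16 * B ^+ 3.
have B20 : 0 < B ^+ 2 by rewrite exprn_gt0.
have M0 : 0 < M by rewrite mulr_gt0// exprn_gt0.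
have MB0 : 0 < M * B by rewrite mulr_gt0.
have MM0 : 0 < M * M by rewrite mulr_gt0.
have MB20 : 0 < M * B ^+ 2 by rewrite mulr_gt0.
(* [N] adds up the factors whose product with [mu * L] or with [mu] has to stay below 1, and [L1]
   adds to [4 * N] the lower bounds required of [L]. *)
pose N := 41 * B + 8 * B ^+ 2 + M * B + 2 * (M * M) + 16 * (M * B ^+ 2).
pose L1 := 4 * N + B ^+ 2 + 2 * M + C0 + 1 + B.
(* The shift takes [16 * B]. The remaining [B] makes the argument of the shock at least
   [A * B * L >= 1], so the shock exceeds 1/3 and outweighs [c]: the barrier is nonnegative there
   and [v] cannot vanish. *)
exists (17 * B), (expR (- L1)).
have L10 : 0 < L1 by rewrite /L1 /N; move: B0 B20 M0 MB0 MM0 MB20 C00; clear; lra.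
split; first by rewrite mulr_gt0// expR_gt0 expR_lt1 oppr_lt0.
move=> mu F dF X dX A dA v /andP[mu0 mu1] coef vsol vdata x t x01 t0T vx0.
pose L := - ln mu.
have muE : mu = expR (- L) by rewrite /L opprK lnK// posrE.
have L1L : L1 <= L by rewrite -lerN2 -ler_expR -muE.
have L0 : 0 < L by exact: lt_le_trans L1L.
have -> : `|ln mu| = L by rewrite -normrN gtr0_norm.
have N0 : 0 < N by rewrite /N; move: B0 B20 M0 MB0 MM0 MB20; clear; lra.
have muL : mu * L * N <= 1.
  have h1 : L * expR (- L) <= 2 * expR (- (L / 2)) := mul_expRN_le L.
  have h2 : expR (- (L / 2)) * (L / 2) <= 1.
    rewrite mulrC expRN ler_pdivrMr ?expR_gt0// mul1r.
    by apply: le_trans (expR_ge1Dx _); lra.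
  have h3 : mu * L * L <= 4.
    have : mu * L * L <= 2 * expR (- (L / 2)) * L.
      by rewrite ler_pM2r// mulrC muE.
    by move: h2; clear; lra.
  have h4 : mu * L * (4 * N) <= mu * L * L.
    rewrite ler_pM2l ?mulr_gt0//; apply: le_trans L1L; rewrite /L1.
    by move: B0 B20 M0 C00; clear; lra.
  by move: h3 h4; clear; lra.
have L1' : 1 <= L.
  apply: le_trans L1L; rewrite /L1.
  by move: N0 B0 B20 M0 C00; clear; lra.
have muL0 : 0 < mu * L by rewrite mulr_gt0.
have mumuL : mu <= mu * L by rewrite ler_peMr// ltW.
have mu_small k r : 0 <= k -> 0 <= r -> k + r = N -> mu * L * k <= 1 /\ mu * k <= 1.
  move=> k0 r0 kN.
  have h : mu * L * k <= 1.
    apply: le_trans muL; rewrite ler_pM2l// -kN; move: r0; clear; lra.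
  by split=> //; apply: le_trans h; rewrite ler_wpM2r.
have mu1' : mu < 1 by rewrite muE expR_lt1 oppr_lt0.
pose s := 16 * B * (mu * L).
pose c := mu * (2 * M + C0 + 1).
have facts : [/\ mu * L * (41 * B) <= 1, mu * (8 * B ^+ 2) <= 1, mu * (M * B) <= 1 &
    mu * L * (2 * (M * M) + 16 * (M * B ^+ 2)) <= 1].
  split.
  - apply: (mu_small _ (N - 41 * B) _ _ _).1; rewrite /N;
      move: B0 B20 M0 MB0 MM0 MB20; clear; lra.
  - apply: (mu_small _ (N - 8 * B ^+ 2) _ _ _).2; rewrite /N;
      move: B0 B20 M0 MB0 MM0 MB20; clear; lra.
  - apply: (mu_small _ (N - M * B) _ _ _).2; rewrite /N;
      move: B0 B20 M0 MB0 MM0 MB20; clear; lra.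
  - apply: (mu_small _ (N - (2 * (M * M) + 16 * (M * B ^+ 2))) _ _ _).1; rewrite /N;
      move: B0 B20 M0 MB0 MM0 MB20; clear; lra.
have [f1 f2 f3 f4] := facts.
have LC : 2 * M + C0 + 1 + B <= 8 * L.
  have : 2 * M + C0 + 1 + B <= L.
    by apply: le_trans L1L; rewrite /L1; move: N0 B20; clear; lra.
  by move: L0; clear; lra.
rewrite leNgt; apply/negP => xlt.
have Mb : M * (2 * (mu * M) + B * s) <= 1.
  apply: le_trans f4.
  have : M * (2 * (mu * M)) <= M * (2 * (mu * L * M)).
    by rewrite ler_pM2l// ler_pM2l// ler_pM2r.
  by rewrite /s; clear; lra.
have := @barrier_below R T B C0 mu L M c s F dF X dX A dA v erefl erefl erefl T0 B1
  C00 mu0 _ _ LC f2 _ Mb _ coef vsol vdata x t 1 x01 t0T (or_introl erefl).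
rewrite vx0 => h.
have {h} : barrier mu M c s 1 A X x t < 0.
  apply: h.
  - by rewrite /s; move: f1 muL0 B0; clear; nra.
  - by apply: le_trans L1L; rewrite /L1; move: N0 B0 M0 C00; clear; lra.
  - by rewrite -mulrA.
  - by rewrite (_ : mu ^+ 2 = expR (- (2 * L)))// muE -expRM_natl mulrN.
apply/negP; rewrite -leNgt /barrier mul1r.
have [_ _ /(_ t t0T)[_ [A1 AB] _ _ _]] := coef.
have A0 : 0 < A t by rewrite -(pmulr_lgt0 _ B0); exact: lt_le_trans A1.
have y0 : B * (mu * L) <= x - (X t + s) by move: xlt; rewrite /s; clear; lra.
have By0 : 0 < B * (mu * L) by rewrite mulr_gt0.
have hs : 1 / 3 <= shock (A t / mu * (x - (X t + s))).
  apply: shock_ge.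
  apply: (@le_trans _ _ (A t / mu * (B * (mu * L)))); last first.
    by rewrite ler_pM2l// divr_gt0.
  rewrite (_ : _ * _ = A t * B * L); last by field; rewrite gt_eqF.
  exact: mulr_ege1.
have h1 : A t * (1 / 3) <= A t * shock (A t / mu * (x - (X t + s))).
  by rewrite ler_pM2l.
have h2 : 0 <= mu * M * (x - (X t + s)).
  by apply: mulr_ge0 (le_trans (ltW By0) y0); apply/ltW/mulr_gt0.
have h3 : c <= A t * (1 / 3).
  have k1 : c <= 8 * (mu * L).
    rewrite (_ : 8 * _ = mu * (8 * L)); last by ring.
    by rewrite ler_pM2l//; move: LC B0; clear; lra.
  have k2 : 24 * (mu * L) * B <= A t * B.
    by apply: le_trans A1; move: f1 muL0 B0 By0; clear; lra.
  by rewrite ler_pM2r// in k2; move: k1 k2; clear; lra.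
by move: h1 h2 h3; clear; lra.
Qed.

(** Under [x -> 1 - x], [v -> - v] and [X -> 1 - X], the function [vx] is preserved while [vxx],
    [vt], [v], [x - X] and [dX] change sign, so both sides of the equation do. A bound on zeros from
    the right thus becomes one from the left. *)
Lemma layer_solution_reflect (R : realType) (T mu : R) (F dF X dX : R -> R)
    (v : R -> R -> R) :
  layer_solution T mu F dF X dX v ->
  layer_solution T mu F dF (fun t => 1 - X t) (fun t => - dX t)
    (fun x t => - v (1 - x) t).
Proof.
move=> [cv [vx [vxx [vt hv]]]]; split.
  apply/subspace_continuousP => p Kp.
  have Krp : (`[0, 1] `*` `[0, T] : set (R * R)) (1 - p.1, p.2).
    case: Kp => /=; rewrite !in_itv/= => p1 p2; split=> //=.
    by move: p1; clear; case: p => p1 p2 /=; lra.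
  have /subspace_continuousP/(_ _ Krp) cvp := cv.
  apply: cvgN; apply: (cvg_comp (fun q : R * R => (1 - q.1, q.2)) _ _ cvp).
  move=> S /= [[S1 S2] /= [hS1 hS2] hS].
  have c1 : (fun q : R * R => 1 - q.1) @ p --> 1 - p.1.
    by apply: cvgB; [exact: cvg_cst|exact: cvg_fst].
  have c2 : (fun q : R * R => q.2) @ p --> p.2 by exact: cvg_snd.
  change (\forall q \near p, (`[0, 1] `*` `[0, T] : set (R * R)) q ->
    S (1 - q.1, q.2)).
  near=> q => -[]; rewrite /= !in_itv/= => q1 q2.
  apply: (hS (1 - q.1, q.2)); split=> /=.
  - by near: q; exact: (c1 _ hS1).
  - by near: q; exact: (c2 _ hS2).
  - by rewrite in_itv/=; move: q1; clear; lra.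
  - by rewrite in_itv.
have dr (x : R) : is_derive x 1 (fun u : R => 1 - u) (-1).
  by rewrite -[X in is_derive _ _ _ X]sub0r; exact: is_deriveB.
exists (fun x t => vx (1 - x) t), (fun x t => - vxx (1 - x) t), (fun x t => - vt (1 - x) t).
move=> x t x01 t0T.
have x01' : 0 < 1 - x < 1 by move: x01; clear; lra.
have [h1 h2 h3 h4] := hv _ _ x01' t0T; split.
- have h := @is_derive1_comp R (v^~ t) (fun u => 1 - u) x _ _ h1 (dr x).
  have {}h := is_deriveN h.
  by apply: is_derive_eqP h _ _ => //; rewrite mulrN1 opprK.
- have h := @is_derive1_comp R (vx^~ t) (fun u => 1 - u) x _ _ h2 (dr x).
  by apply: is_derive_eqP h _ _ => //; rewrite mulrN1.
- exact: is_deriveN.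
- move: h4; clear; lra.
Unshelve. all: by end_near. Qed.

Lemma layer_position (R : realType) (T B C0 : R) :
  0 < T -> 1 <= B -> 0 <= C0 ->
  exists K mu1 : R, [/\ 0 < K, 0 < mu1 & mu1 < 1] /\
  forall (mu : R) (F dF X dX A dA : R -> R) (v : R -> R -> R), 0 < mu <= mu1 ->
    layer_coefficients T B F dF X dX A dA ->
    layer_solution T mu F dF X dX v ->
    (forall t : R, 0 <= t <= T -> v 0 t = - A t) ->
    (forall t : R, 0 <= t <= T -> v 1 t = A t) ->
    (forall x : R, 0 <= x <= 1 ->
       `|v x 0 - A 0 * shock (A 0 / mu * (x - X 0))| <= C0 * mu) ->
    forall x t : R, 0 <= x <= 1 -> 0 <= t <= T ->
      v x t = 0 -> `|x - X t| <= K * (mu * `|ln mu|).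
Proof.
move=> T0 B1 C00.
have [K [mu1 [K0 hK]]] := layer_right_bound T0 B1 C00.
exists K, mu1; split=> // mu F dF X dX A dA v hmu coef vsol v0 v1 vi x t x01 t0T vx0.
have r : x <= X t + K * (mu * `|ln mu|).
  apply: (hK _ _ _ _ _ _ _ _ hmu coef vsol) vx0 => //; split.
  - by move=> u /v0 ->.
  - by move=> u /v1 ->.
  - by move=> y /vi; rewrite ler_norml => /andP[+ _]; clear; lra.
have l : 1 - x <= 1 - X t + K * (mu * `|ln mu|).
  apply: (hK _ _ _ _ _ A dA _ hmu _ (layer_solution_reflect vsol)) => //.
  - have [dXP dAP bnd] := coef; split=> // u.
      have -> : - dX u = 0 - dX u by rewrite sub0r.
      by apply: is_deriveB.
    move=> u0T; have [X01 ? ? ? ?] := bnd u u0T; split=> //.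
      by move: X01; clear; lra.
    by rewrite normrN.
  - split.
    + by move=> u /v1; rewrite subr0 => ->.
    + by move=> u /v0; rewrite subrr => ->; rewrite opprK.
    + move=> y y01; have y01' : 0 <= 1 - y <= 1 by move: y01; clear; lra.
      have := vi _ y01'.
      rewrite (_ : A 0 / mu * (1 - y - X 0) = - (A 0 / mu * (y - (1 - X 0)))); last by ring.
      by rewrite shockN mulrN opprK ler_norml; clear; lra.
  - by move: x01; clear; lra.
  - by rewrite subKr vx0 oppr0.
by rewrite ler_norml; move: r l; clear; lra.
Qed.

(** * Interpolation at the nodes *)

(** The squared norm, extended-valued so that it can be split over the cells before it is known to
    be finite. *)
Definition sqint (R : realType) (a b : R) (g : R -> R) : \bar R :=
  (\int[@lebesgue_measure R]_(x in `[a, b]) (g x ^+ 2)%:E)%E.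

Lemma sqint_ge0 (R : realType) (a b : R) (g : R -> R) : (0 <= sqint a b g)%E.
Proof. by apply: integral_ge0 => x _; rewrite lee_fin sqr_ge0. Qed.

Lemma L2normE (R : realType) (T : R) (g : R -> R) :
  L2norm T g = sqrte (sqint 0 T g).
Proof.
rewrite -poweR12_sqrt ?sqint_ge0// /L2norm unlock; congr poweR.
rewrite /sqint [RHS]integral_mkcond; apply: eq_integral => x _.
rewrite restrict_EFin /= !patchE; case: ifPn => _.
  by rewrite powR_mulrn// real_normK// num_real.
by rewrite normr0 powR0.
Qed.

Lemma L2norm_le (R : realType) (T c : R) (g : R -> R) : 0 <= c ->
  (L2norm T g <= c%:E)%E = (sqint 0 T g <= (c ^+ 2)%:E)%E.
Proof.
move=> c0; rewrite L2normE; have := sqint_ge0 0 T g.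
case: (sqint 0 T g) => [r||]//=; rewrite !lee_fin => r0.
by rewrite -{1}[c]ger0_norm// -sqrtr_sqr ler_psqrt// ?nnegrE// sqr_ge0.
Qed.

Lemma ge0_integral_itv_cat (R : realType) (a b c : R) (f : R -> R) :
  a <= b <= c -> measurable_fun `[a, c] f -> (forall x, 0 <= f x) ->
  (\int[@lebesgue_measure R]_(x in `[a, c]) (f x)%:E =
   \int[@lebesgue_measure R]_(x in `[a, b]) (f x)%:E +
   \int[@lebesgue_measure R]_(x in `[b, c]) (f x)%:E)%E.
Proof.
move=> /andP[ab bc] mf f0.
have mfr : measurable_fun `]b, c] f.
  by apply: measurable_funS mf => //; apply: subset_itvr; rewrite bnd_simp.
rewrite -(@integral_itv_obnd_cbnd R b (BRight c)); last exact/measurable_EFinP.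
rewrite (@itv_bndbnd_setU _ _ _ (BRight b)) ?bnd_simp//.
rewrite ge0_integral_setU//; first last.
- apply/disj_setPS => x [/=]; rewrite !in_itv/= => /andP[_ xb] /andP[].
  by rewrite ltNge xb.
- by move=> x _; rewrite lee_fin.
- by rewrite -itv_bndbnd_setU ?bnd_simp//; exact/measurable_EFinP.
Qed.

Lemma ge0_integral_grid (R : realType) (h : R) (n : nat) (f : R -> R) :
  0 <= h -> measurable_fun `[0, n%:R * h] f -> (forall x, 0 <= f x) ->
  (\int[@lebesgue_measure R]_(x in `[0%R, (n%:R * h)%R]) (f x)%:E =
   \sum_(i < n) \int[@lebesgue_measure R]_(x in `[(i%:R * h)%R, (i.+1%:R * h)%R]) (f x)%:E)%E.
Proof.
move=> h0; elim: n => [|n IH] mf f0.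
  by rewrite big_ord0 mul0r set_itv1 integral_set1.
have le1 : n%:R * h <= n.+1%:R * h by rewrite ler_wpM2r// ler_nat.
rewrite big_ord_recr/= -IH//; last first.
  by apply: measurable_funS mf => //; apply: subset_itvl; rewrite bnd_simp.
by apply: ge0_integral_itv_cat => //; rewrite mulr_ge0.
Qed.

Lemma le_integral_itv_cst (R : realType) (a b c : R) (f : R -> R) : a <= b ->
  measurable_fun `[a, b] f ->
  (forall x, a <= x <= b -> 0 <= f x <= c) ->
  (\int[@lebesgue_measure R]_(x in `[a, b]) (f x)%:E <= ((b - a) * c)%:E)%E.
Proof.
move=> ab mf fc.
apply: (@le_trans _ _ (\int[@lebesgue_measure R]_(x in `[a, b]) (cst c%:E) x)%E).
  apply: ge0_le_integral => //=.
  - by move=> x; rewrite in_itv/= lee_fin => /fc /andP[].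
  - exact/measurable_EFinP.
  - by move=> x; rewrite in_itv/= lee_fin => /fc /andP[].
rewrite integral_cst//= lebesgue_measure_itv/= lte_fin; case: ltP => [_|ba].
  by rewrite -EFinB -EFinM mulrC.
by rewrite mule0 (le_anti (introT andP (conj ab ba))) subrr mul0r.
Qed.

(** Cauchy-Schwarz against the constant 1, by integrating [|g| <= l / 2 + g^2 / (2 l)]. The choice
    [l = 1] gives integrability; then [l] is taken to be the mean of [|g|], which makes the first
    term half of the left-hand side. *)
Lemma sqr_Rintegral_le (R : realType) (a b : R) (g : R -> R) : a < b ->
  measurable_fun `[a, b] g -> (sqint a b g < +oo)%E ->
  (@lebesgue_measure R).-integrable `[a, b] (EFin \o g) /\
  (((\int[@lebesgue_measure R]_(x in `[a, b]) `|g x|) ^+ 2)%R%:E <=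
    (b - a)%R%:E * sqint a b g)%E.
Proof.
move=> ab mg sg.
have msq : measurable_fun `[a, b] (fun x => g x ^+ 2) by exact: measurable_funX.
have mab : measurable_fun `[a, b] (fun x => `|g x|) by exact: measurableT_comp.
pose S := fine (sqint a b g).
have SE : sqint a b g = S%:E by rewrite fineK// ge0_fin_numE// sqint_ge0.
have S0 : 0 <= S by rewrite fine_ge0// sqint_ge0.
have lin (p q : R) : 0 <= p -> 0 <= q ->
    (\int[@lebesgue_measure R]_(x in `[a, b]) (p + q * g x ^+ 2)%R%:E =
      (p * (b - a) + q * S)%R%:E)%E.
  move=> p0 q0; have qsq x : (0 <= (q * g x ^+ 2)%:E)%E.
    by rewrite lee_fin mulr_ge0// sqr_ge0.
  under eq_integral do rewrite EFinD.
  rewrite ge0_integralD//=; last first.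
    by apply/measurable_EFinP; exact: measurable_funM.
  under [X in (_ + X)%E]eq_integral do rewrite EFinM.
  rewrite ge0_integralZl_EFin//=; last 2 first.
  - by move=> x _; rewrite lee_fin sqr_ge0.
  - exact/measurable_EFinP.
  by rewrite -/(sqint a b g) SE integral_cst//= lebesgue_measure_itv/= lte_fin ab.
have amgm l : 0 < l -> (\int[@lebesgue_measure R]_(x in `[a, b]) `|g x|%:E <=
    (l * (b - a) / 2 + S / (2 * l))%:E)%E.
  move=> l0.
  apply: (@le_trans _ _ (\int[@lebesgue_measure R]_(x in `[a, b])
     (l / 2 + (2 * l)^-1 * g x ^+ 2)%R%:E)%E).
    apply: ge0_le_integral => //=.
    - exact/measurable_EFinP.
    - apply/measurable_EFinP; apply: measurable_funD => //.
      exact: measurable_funM.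
    - move=> x _; rewrite lee_fin.
      rewrite -subr_ge0 (_ : _ - _ = (2 * l)^-1 * (`|g x| - l) ^+ 2).
        by rewrite mulr_ge0 ?sqr_ge0// invr_ge0 mulr_ge0// ltW.
      by rewrite -[g x ^+ 2]real_normK ?num_real//; field; rewrite gt_eqF.
  rewrite lin ?divr_ge0 ?invr_ge0 ?mulr_ge0 ?(ltW l0)// lee_fin.
  by rewrite mulrAC [_ * S]mulrC.
have fin : (\int[@lebesgue_measure R]_(x in `[a, b]) `|g x|%:E < +oo)%E.
  by apply: le_lt_trans (amgm 1 ltr01) _; rewrite ltry.
split.
  by apply/integrableP; split => //; exact/measurable_EFinP.
pose D := \int[@lebesgue_measure R]_(x in `[a, b]) `|g x|.
have DE : (\int[@lebesgue_measure R]_(x in `[a, b]) `|g x|%:E = D%:E)%E.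
  by rewrite fineK// ge0_fin_numE// integral_ge0.
have D0 : 0 <= D by apply: Rintegral_ge0.
rewrite SE -EFinM lee_fin -/D.
have {}amgm l : 0 < l -> D <= l * (b - a) / 2 + S / (2 * l).
  by move=> /amgm; rewrite DE lee_fin.
have ba0 : 0 < b - a by rewrite subr_gt0.
have [D00|Dp] := leP D 0.
  have -> : D = 0 by apply/le_anti; rewrite D00.
  by rewrite expr0n/= mulr_ge0// ltW.
have l0 : 0 < D / (b - a) by rewrite divr_gt0.
have := amgm _ l0.
rewrite (_ : _ + _ = D / 2 + S * (b - a) / (2 * D)); last first.
  by field; rewrite !gt_eqF.
move=> h; rewrite expr2.
have {}h : D / 2 <= S * (b - a) / (2 * D) by move: h; clear; lra.
move: h; rewrite ler_pdivlMr ?mulr_gt0//; clear; lra.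
Qed.

Lemma continuous_itv_bounded (R : realType) (a b : R) (g : R -> R) : a <= b ->
  {within `[a, b], continuous g} ->
  exists2 B : R, 0 <= B & forall x, a <= x <= b -> `|g x| <= B.
Proof.
move=> ab cg.
have cn : {within `[a, b], continuous (fun x => `|g x|)}.
  by move=> x; apply: continuous_comp; [exact: cg|exact: norm_continuous].
have [c cab hc] := EVT_max ab cn.
by exists `|g c| => // x xab; apply: hc; rewrite in_itv.
Qed.

Lemma itv_jet_of_derivatives (R : realType) (T : R) (G0 G1 G2 : R -> R) :
  (forall t : R, is_derive t 1 G0 (G1 t)) -> (forall t : R, is_derive t 1 G1 (G2 t)) ->
  exists G, [/\ G 0%N = G0, G 1%N = G1 & itv_jet 0 T 1 G].
Proof.
move=> d0 d1; exists (fun j => if j is 0%N then G0 else G1); split=> //; split.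
  move=> j j1; apply: continuous_subspaceT => t.
  apply/differentiable_continuous/derivable1_diffP.
  by case: j j1 => [|j] _; [case: (d0 t)|case: (d1 t)].
by move=> [|//] _ x _; exact: d0.
Qed.

Lemma L2_second_derivative_continuous (R : realType) (T : R) (G0 G1 G2 : R -> R) :
  0 < T ->
  (forall t : R, is_derive t 1 G0 (G1 t)) -> (forall t : R, is_derive t 1 G1 (G2 t)) ->
  continuous G2 -> L2_second_derivative T G0 G2.
Proof.
move=> T0 d0 d1 c2.
have mG2 : measurable_fun `[0, T] G2.
  by apply: measurable_funTS; exact: continuous_measurable_fun.
split=> //.
  have [B B0 hB] := continuous_itv_bounded (ltW T0) (continuous_subspaceT c2).
  rewrite L2normE.
  have h : (sqint 0 T G2 <= (T * B ^+ 2)%:E)%E.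
    rewrite -[X in (X * _)%:E]subr0; apply: le_integral_itv_cst => //; first exact: ltW.
      exact: measurable_funX.
    move=> x /hB hx; rewrite sqr_ge0 -[G2 x ^+ 2]real_normK ?num_real//=.
    by rewrite lerXn2r ?nnegrE.
  apply: (@le_lt_trans _ _ (sqrte (T * B ^+ 2)%:E)); last by rewrite ltry.
  by rewrite lee_sqrt// (le_trans (sqint_ge0 _ _ _) h).
have [G [GG0 GG1 hG]] := itv_jet_of_derivatives T d0 d1.
exists G; split=> // t; rewrite GG1 => /andP[]; rewrite le_eqVlt => /predU1P[<-|t0] tT.
  by rewrite set_itv1 Rintegral_set1 addr0.
rewrite /Rintegral (@continuous_FTC2 _ G2 G1 0 t t0)//.
- by rewrite addrC -EFinB/= subrK.
- exact: continuous_subspaceT.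
- split.
  + by move=> x _; case: (d1 x).
  + apply: cvg_at_right_filter; apply/differentiable_continuous/derivable1_diffP.
    by case: (d1 0).
  + apply: cvg_at_left_filter; apply/differentiable_continuous/derivable1_diffP.
    by case: (d1 t).
- by move=> x _; rewrite derive1E; case: (d1 x).
Qed.

(** * Nodal bumps of class [C^2] *)

Lemma is_derive_quadratic (R : realType) (h : R -> R) (x d C : R) :
  (forall k : R, `|k| <= 1 -> `|h (k + x) - h x - d * k| <= C * k ^+ 2) ->
  is_derive x 1 h d.
Proof.
move=> hC.
have cv : (fun k : R => k^-1 *: (h (k *: 1 + x) - h x)) @ 0^' --> d.
  apply/cvgrPdist_le => e e0.
  have C0 : 0 < `|C| + 1 by rewrite ltr_wpDl.
  near=> k.
  have k0 : k != 0 by near: k; exact: nbhs_dnbhs_neq.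
  have k1 : `|k| <= Num.min 1 (e / (`|C| + 1)).
    near: k; apply: dnbhs0_le; rewrite lt_min ltr01 divr_gt0//.
  move: k1; rewrite le_min => /andP[k1 ke].
  rewrite [k%:A]mulr1.
  rewrite (_ : d - _ = - (k^-1 * (h (k + x) - h x - d * k))); last first.
    by rewrite /GRing.scale/=; field.
  rewrite normrN normrM normfV ler_pdivrMl ?normr_gt0//.
  apply: (le_trans (hC _ k1)); rewrite -[k ^+ 2]real_normK ?num_real// expr2.
  rewrite mulrCA ler_pM2l ?normr_gt0//.
  have h1 : C * `|k| <= (`|C| + 1) * `|k|.
    by rewrite ler_wpM2r// (le_trans (ler_norm _))// lerDl.
  apply: (le_trans h1); rewrite mulrC -ler_pdivlMr//.
apply: DeriveDef; first by apply/cvg_ex; exists d.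
by apply: cvg_lim.
Unshelve. all: by end_near. Qed.

Lemma is_derive_exprn (R : realType) (n : nat) (x : R) :
  is_derive x 1 (fun u : R => u ^+ n) (n%:R * x ^+ n.-1).
Proof.
by apply: DeriveDef; [exact: exprn_derivable|rewrite -derive1E exp_derive1].
Qed.

Lemma is_derive_max0X (R : realType) (n : nat) (x : R) :
  is_derive x 1 (fun u : R => Num.max 0 u ^+ n.+2) (n.+2%:R * Num.max 0 x ^+ n.+1).
Proof.
have [x0|x0|->] := ltgtP x 0.
- rewrite expr0n mulr0.
  apply: near_eq_is_derive (is_derive_cst (0 : R) x 1).
  near=> u.
  rewrite max_l ?expr0n//.
  by apply/ltW; near: u; exact: lt_nbhsl.
- apply: near_eq_is_derive (is_derive_exprn n.+2 x).
  near=> u.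
  rewrite max_r//.
  by apply/ltW; near: u; exact: lt_nbhsr.
- rewrite expr0n mulr0; apply: (@is_derive_quadratic _ _ _ _ 1) => k k1.
  rewrite addr0 maxxx expr0n/= !subr0 mul0r subr0 mul1r.
  have [k0|k0] := leP 0 k; last by rewrite expr0n normr0 sqr_ge0.
  rewrite ger0_norm ?exprn_ge0// -addn2 exprD ler_piMl ?sqr_ge0//.
  by rewrite exprn_ile1//; move: k1; rewrite ger0_norm.
Unshelve. all: by end_near. Qed.

(** The cube is the lowest power for which the truncation is [C^2]. The value 1 at 0 and the support
    [[-1, 1]] make the translates rescaled to the mesh equal to 1 at their own node and to 0 at all
    others. *)
Definition bump (R : realType) (t : R) : R := Num.max 0 (1 - t ^+ 2) ^+ 3.
Definition bump_d1 (R : realType) (t : R) : R :=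
  - (6 * t * Num.max 0 (1 - t ^+ 2) ^+ 2).
Definition bump_d2 (R : realType) (t : R) : R :=
  24 * t ^+ 2 * Num.max 0 (1 - t ^+ 2) - 6 * Num.max 0 (1 - t ^+ 2) ^+ 2.

Lemma is_derive_max0X_comp (R : realType) (n : nat) (x : R) :
  is_derive x 1 (fun u : R => Num.max 0 (1 - u ^+ 2) ^+ n.+2)
    (n.+2%:R * Num.max 0 (1 - x ^+ 2) ^+ n.+1 * - (2 * x)).
Proof.
have d1 : is_derive x 1 (fun u : R => 1 - u ^+ 2) (- (2 * x)).
  have d := is_deriveB (is_derive_cst (1 : R) x 1)
    (is_derive_exprn 2 x).
  apply: is_derive_eqP d _ _ => //.
  by rewrite sub0r expr1.
exact: (@is_derive1_comp R (fun u => Num.max 0 u ^+ n.+2) (fun u => 1 - u ^+ 2)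
  x _ _ (is_derive_max0X n (1 - x ^+ 2)) d1).
Qed.

Lemma is_derive_bump (R : realType) (t : R) : is_derive t 1 (@bump R) (bump_d1 t).
Proof.
by apply: is_derive_eqP (is_derive_max0X_comp 1 t) _ _ => //; rewrite /bump_d1; ring.
Qed.

Lemma is_derive_bump1 (R : realType) (t : R) : is_derive t 1 (@bump_d1 R) (bump_d2 t).
Proof.
have d := is_deriveZ (-6) (is_deriveM (is_derive_id t 1) (is_derive_max0X_comp 0 t)).
apply: is_derive_eqP d _ _ => [u|].
  by transitivity (-6 * (u * Num.max 0 (1 - u ^+ 2) ^+ 2)) => //; rewrite /bump_d1; ring.
set m := Num.max 0 (1 - t ^+ 2).
transitivity (-6 * (t * (2%:R * m ^+ 1 * - (2 * t)) + m ^+ 2 * 1)) => //.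
by rewrite /bump_d2 -/m; ring.
Qed.

Lemma bump0 (R : realType) : bump (0 : R) = 1.
Proof. by rewrite /bump expr0n subr0 max_r// expr1n. Qed.

Lemma bump_out (R : realType) (t : R) : 1 <= `|t| -> bump t = 0 /\ bump_d2 t = 0.
Proof.
move=> t1; have h : 1 - t ^+ 2 <= 0.
  by rewrite subr_le0 -[t ^+ 2]real_normK ?num_real// exprn_ege1.
by rewrite /bump /bump_d2 max_l// !expr0n/= !mulr0 subr0.
Qed.

Lemma bump_d2_le (R : realType) (t : R) : `|bump_d2 t| <= 24.
Proof.
have [t1|t1] := leP 1 `|t|.
  by rewrite (bump_out t1).2 normr0.
have : 0 <= t ^+ 2 <= 1.
  by rewrite sqr_ge0 -[t ^+ 2]real_normK ?num_real// exprn_ile1// ltW.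
rewrite /bump_d2; move: (t ^+ 2) => q /andP[q0 q1].
rewrite max_r ?subr_ge0// ler_norml; nra.
Qed.

Lemma continuous_bump_d2 (R : realType) : continuous (@bump_d2 R).
Proof.
move=> t.
have cm : {for t, continuous (fun u : R => Num.max 0 (1 - u ^+ 2))}.
  apply: (@continuous_max R R (cst 0) (fun u : R => 1 - u ^+ 2)).
    exact: cst_continuous.
  by apply: continuousB; [exact: cst_continuous|exact: exprn_continuous].
have c2 : {for t, continuous (fun u : R => 24 * u ^+ 2)}.
  by apply: continuousM; [exact: cst_continuous|exact: exprn_continuous].
apply: (@continuousB R R R (fun u : R => 24 * u ^+ 2 * Num.max 0 (1 - u ^+ 2))
  (fun u : R => 6 * Num.max 0 (1 - u ^+ 2) ^+ 2)).
  exact: continuousM.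
apply: (@continuousM R R (cst 6) (fun u : R => Num.max 0 (1 - u ^+ 2) ^+ 2)).
  exact: cst_continuous.
exact: (continuousM cm cm).
Qed.

Definition translates (R : realType) (h : R) (n : nat) (e : nat -> R) (g : R -> R)
    (t : R) : R :=
  \sum_(i < n) e i * g (h^-1 * (t - i%:R * h)).

Lemma is_derive_translates (R : realType) (h : R) (n : nat) (e : nat -> R)
    (g dg : R -> R) (t : R) :
  (forall u : R, is_derive u 1 g (dg u)) ->
  is_derive t 1 (translates h n e g) (h^-1 * translates h n e dg t).
Proof.
move=> hg.
have d (i : 'I_n) : is_derive t 1 (e i *: (fun u : R => g (h^-1 * (u - i%:R * h))) : R -> R)
    (e i *: (dg (h^-1 * (t - i%:R * h)) * h^-1)).
  apply: is_deriveZ.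
  exact: (@is_derive1_comp R g (fun u => h^-1 * (u - i%:R * h)) t _ _
    (hg _) (is_derive_affine h^-1 (i%:R * h) t)).
apply: is_derive_eqP (is_derive_sum d) _ _ => [u|].
  by rewrite fct_sumE.
rewrite /translates mulr_sumr; apply: eq_bigr => i _.
by rewrite /GRing.scale/=; ring.
Qed.

Lemma continuous_translates (R : realType) (h : R) (n : nat) (e : nat -> R)
    (g : R -> R) : continuous g -> continuous (translates h n e g).
Proof.
move=> cg; elim: n => [|n IH] t.
  rewrite /translates (_ : (fun _ => _) = cst 0); first exact: cst_continuous.
  by apply/funext => u; rewrite big_ord0.
rewrite (_ : translates h n.+1 e g = translates h n e g +
    (fun u => e n * g (h^-1 * (u - n%:R * h)))); last first.
  by apply/funext => u; rewrite /translates big_ord_recr.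
apply: continuousD; first exact: IH.
apply: cvgM; first exact: cvg_cst.
apply: (@continuous_comp _ _ _ (fun u : R => h^-1 * (u - n%:R * h)) g); last exact: cg.
by apply: cvgM; [exact: cvg_cst|apply: cvgB; [exact: cvg_id|exact: cvg_cst]].
Qed.

Lemma sum_delta (R : realType) (n j : nat) (F : nat -> R) : (j < n)%N ->
  \sum_(i < n) F i * (i == j :> nat)%:R = F j.
Proof.
move=> jn; rewrite (bigD1 (Ordinal jn))//= eqxx mulr1 big1 ?addr0// => i.
by move=> ij; rewrite (_ : _ == _ = false) ?mulr0//; apply/negbTE.
Qed.

Lemma translates_grid (R : realType) (h : R) (n j : nat) (e : nat -> R) (g : R -> R) :
  h != 0 -> (j < n)%N -> g 0 = 1 -> (forall t : R, 1 <= `|t| -> g t = 0) ->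
  translates h n e g (j%:R * h) = e j.
Proof.
move=> h0 jn g0 g1; rewrite -(sum_delta e jn); apply: eq_bigr => i _; congr (_ * _).
rewrite (_ : h^-1 * _ = j%:R - i%:R); last by field.
have [->|ij] := eqVneq (i : nat) j; first by rewrite subrr g0.
apply: g1; rewrite distrC.
have [lt|lt|/eqP] := ltngtP i j; last by rewrite (negbTE ij).
  rewrite distrC ger0_norm ?subr_ge0 ?ler_nat 1?ltnW//.
  by rewrite lerBrDr nat1r ler_nat.
rewrite ger0_norm ?subr_ge0 ?ler_nat 1?ltnW//.
by rewrite lerBrDr nat1r ler_nat.
Qed.

(** On a cell only the translates centred at its two ends can be nonzero. *)
Lemma translates_le (R : realType) (h C t : R) (n j : nat) (e : nat -> R) (g : R -> R) :
  0 < h -> (j.+1 < n)%N -> (forall t : R, 1 <= `|t| -> g t = 0) ->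
  (forall t : R, `|g t| <= C) -> j%:R * h <= t <= j.+1%:R * h ->
  `|translates h n e g t| <= C * (`|e j| + `|e j.+1|).
Proof.
move=> h0 jn g1 gC tj.
apply: le_trans (ler_norm_sum _ _ _) _.
(* The two end values are written as sums against Kronecker deltas, so that the inequality can be
   checked term by term. *)
rewrite -(sum_delta (fun i => `|e i|) jn) -(sum_delta (fun i => `|e i|) (ltnW jn)).
rewrite -big_split /= mulr_sumr; apply: ler_sum => i _.
rewrite normrM -mulrDr mulrCA ler_wpM2l//.
have C0 : 0 <= C by exact: le_trans (gC 0).
have [ij|ij] := eqVneq (i : nat) j.
  apply: le_trans (gC _) _; rewrite ler_peMr// lerDl//.
have [ij1|ij1] := eqVneq (i : nat) j.+1.
  by apply: le_trans (gC _) _; rewrite add0r mulr1.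
rewrite g1 ?normr0 ?addr0 ?mulr0//.
have /andP[t1 t2] := tj.
have [lt|] := ltnP i j.
  have : i.+1%:R * h <= t by apply: le_trans t1; rewrite ler_wpM2r ?ler_nat// ltW.
  rewrite -ler_pdivlMr// => k1.
  rewrite (_ : h^-1 * _ = t / h - i%:R); last by field; rewrite gt_eqF.
  apply: le_trans (ler_norm _); move: k1; rewrite -natr1; lra.
rewrite leq_eqVlt eq_sym (negbTE ij)/= leq_eqVlt eq_sym (negbTE ij1)/= => lt.
have : t <= i%:R * h - h.
  apply: (le_trans t2); rewrite -[X in _ - X]mul1r -mulrBl ler_wpM2r ?(ltW h0)//.
  by rewrite lerBrDr natr1 ler_nat.
move=> k1; rewrite -normrN; apply: le_trans (ler_norm _).
rewrite -mulrN ler_pdivlMl// mulr1; lra.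
Qed.

(** Some value of [e1] is the slope of the chord, hence all values are within [D] of it, and a
    second use of the mean value theorem, from [a], bounds [e t]. Only the oscillation of [e1] is
    involved, which suits a second derivative that is merely square integrable. *)
Lemma endpoints_sup_bound (R : realType) (a b D : R) (e e1 : R -> R) : a < b ->
  {within `[a, b], continuous e} ->
  (forall x : R, x \in `]a, b[ -> is_derive x 1 e (e1 x)) ->
  (forall s t : R, a <= s <= b -> a <= t <= b -> `|e1 t - e1 s| <= D) ->
  forall t : R, a <= t <= b -> `|e t| <= 2 * `|e a| + `|e b| + (b - a) * D.
Proof.
move=> ab ce de De t tab.
have ba0 : 0 < b - a by rewrite subr_gt0.
have [xi xiab exi] := MVT ab de ce.
have /andP[ta tb] := tab.
have [|||tau tauat etau] := @MVT_segment R e e1 a t.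
- by [].
- by move=> x; rewrite in_itv/= => /andP[ax xt]; apply: de; rewrite in_itv/= ax (lt_le_trans xt).
- by apply: continuous_subspaceW ce; apply: subset_itvl; rewrite bnd_simp.
have xi' : a <= xi <= b by move: xiab; rewrite in_itv/= => /andP[/ltW -> /ltW ->].
have tau' : a <= tau <= b.
  by move: tauat; rewrite in_itv/= => /andP[-> h]; rewrite (le_trans h).
have h1 := De _ _ xi' tau'.
have h2 : `|e t - e a| <= `|e1 tau| * (b - a).
  rewrite etau normrM ler_wpM2l// ger0_norm ?subr_ge0//.
  by rewrite lerD2r.
have h3 : `|e1 tau| <= `|e1 xi| + D.
  by rewrite -[e1 tau](subrK (e1 xi)) addrC (le_trans (ler_normD _ _))// lerD2l.
have h4 : `|e1 xi| * (b - a) = `|e b - e a|.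
  by rewrite exi normrM (gtr0_norm ba0).
have h5 : `|e1 tau| * (b - a) <= (`|e1 xi| + D) * (b - a) by rewrite ler_pM2r.
have h6 := ler_normB (e b) (e a).
have h7 : `|e t| <= `|e t - e a| + `|e a|.
  by rewrite -{1}[e t](subrK (e a)) ler_normD.
move: h2 h4 h5 h6 h7; clear; lra.
Qed.

Lemma L2_derivative_increment (R : realType) (T a b : R) (g G1 : R -> R) :
  0 <= a -> a < b -> b <= T ->
  (@lebesgue_measure R).-integrable `[0, T] (EFin \o g) ->
  (forall t : R, 0 <= t <= T ->
     G1 t = G1 0 + \int[@lebesgue_measure R]_(s in `[0, t]) g s) ->
  forall s t : R, a <= s <= b -> a <= t <= b ->
    `|G1 t - G1 s| <= \int[@lebesgue_measure R]_(x in `[a, b]) `|g x|.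
Proof.
move=> a0 ab bT ig hG.
have mg : measurable_fun `[0, T] g by apply/measurable_EFinP; case/integrableP: ig.
have igab : (@lebesgue_measure R).-integrable `[a, b] (EFin \o g).
  by apply: integrableS ig => //; apply: subset_itv; rewrite bnd_simp.
have igabN : (@lebesgue_measure R).-integrable `[a, b] (EFin \o (fun x => `|g x|)).
  exact: (integrable_abse igab).
suff main s t : a <= s -> s <= t -> t <= b ->
    `|G1 t - G1 s| <= \int[@lebesgue_measure R]_(x in `[a, b]) `|g x|.
  move=> s t /andP[sa sb] /andP[ta tb].
  have [st|/ltW ts] := leP s t; first exact: main.
  by rewrite distrC; exact: main.
move=> sa st tb.
have s0 : 0 <= s by exact: le_trans sa.
have tT : t <= T by exact: le_trans bT.
rewrite hG; last by rewrite tT (le_trans s0).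
rewrite [in X in _ - X]hG; last by rewrite s0 (le_trans st).
rewrite opprD addrACA subrr add0r.
rewrite Rintegral_itvB ?bnd_simp//; last first.
  by apply: integrableS ig => //; apply: subset_itvl; rewrite bnd_simp.
have sub : `]s, t] `<=` `[a, b] by apply: subset_itv; rewrite bnd_simp.
have igst : (@lebesgue_measure R).-integrable `]s, t] (EFin \o g).
  exact: integrableS igab.
apply: le_trans (le_normr_Rintegral _ igst) _ => //.
have igstN : (@lebesgue_measure R).-integrable `]s, t] (EFin \o (fun x => `|g x|)).
  exact: (integrable_abse igst).
apply: fine_le; [exact: integrable_fin_num|exact: integrable_fin_num|].
apply: ge0_subset_integral => //.
by case/integrableP: igabN.
Qed.

Lemma sqr_sum4_le (R : realType) (a b c d : R) :
  (2 * a + b + c + d) ^+ 2 <= 16 * a ^+ 2 + 4 * b ^+ 2 + 4 * c ^+ 2 + 4 * d ^+ 2.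
Proof.
have h1 := sqr_ge0 (2 * a - b); have h2 := sqr_ge0 (2 * a - c).
have h3 := sqr_ge0 (2 * a - d); have h4 := sqr_ge0 (b - c).
have h5 := sqr_ge0 (b - d); have h6 := sqr_ge0 (c - d).
nra.
Qed.

Lemma sqr_sum3_le (R : realType) (a b c : R) :
  (a + 24 * (b + c)) ^+ 2 <= 2 * a ^+ 2 + 2304 * (b ^+ 2 + c ^+ 2).
Proof.
have h1 := sqr_ge0 (a - 24 * (b + c)); have h2 := sqr_ge0 (b - c).
nra.
Qed.

Lemma sum_pairs_le (R : realType) (n : nat) (a b : R) (F : nat -> R) :
  0 <= a -> 0 <= b -> (forall i, 0 <= F i) ->
  \sum_(i < n) (a * F i + b * F i.+1) <= (a + b) * \sum_(i < n.+1) F i.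
Proof.
move=> a0 b0 F0; rewrite big_split/= -!mulr_sumr mulrDl; apply: lerD.
  by rewrite ler_wpM2l// big_ord_recr/= lerDl.
by rewrite ler_wpM2l// big_ord_recl/= lerDr.
Qed.

(* The competitor is [f] plus bumps carrying the nodal values of [v - f]. *)
Lemma penalty_interpolant (R : realType) (T F2 Q : R) (k : nat)
    (f f1 f2 v : R -> R) :
  0 < T -> (0 < k)%N ->
  (forall t : R, is_derive t 1 f (f1 t)) -> (forall t : R, is_derive t 1 f1 (f2 t)) ->
  continuous f2 -> (forall t : R, 0 <= t <= T -> `|f2 t| <= F2) ->
  (forall w, Ck_itv 0 T 1 w ->
     (forall i, (i <= k)%N -> w (grid T k i) = v (grid T k i)) ->
     (penalty T v <= penalty T w)%E) ->
  T / k%:R * \sum_(i < k.+1) (v (grid T k i) - f (grid T k i)) ^+ 2 <= Q ->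
  (penalty T v <= (Num.sqrt (2 * T * F2 ^+ 2 + 4608 / (T / k%:R) ^+ 4 * Q))%:E)%E.
Proof.
move=> T0 k0 d0 d1 c2 hF2 vmin hQ.
have k0' : 0 < k%:R :> R by rewrite ltr0n.
have [h hE] : exists h, h = T / k%:R by exists (T / k%:R).
rewrite -hE in hQ *.
have h0 : 0 < h by rewrite hE divr_gt0.
have Tkh : T = k%:R * h by rewrite hE mulrC divfK// gt_eqF.
have gridE i : grid T k i = i%:R * h by rewrite /grid hE mulrA.
pose e i := v (i%:R * h) - f (i%:R * h).
have {}hQ : h * \sum_(i < k.+1) e i ^+ 2 <= Q.
  by apply: le_trans hQ; rewrite ler_pM2l// ler_sum// => i _; rewrite gridE.
pose tr := translates h k.+1 e.
pose w := f + tr (@bump R).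
pose w1 := f1 + h^-1 *: tr (@bump_d1 R).
pose w2 := f2 + h^-1 *: (h^-1 *: tr (@bump_d2 R)).
have dw (t : R) : is_derive t 1 w (w1 t).
  by apply: is_deriveD; apply: is_derive_translates; exact: is_derive_bump.
have dw1 (t : R) : is_derive t 1 w1 (w2 t).
  apply: is_deriveD; apply: is_deriveZ.
  by apply: is_derive_translates; exact: is_derive_bump1.
have cw2 : continuous w2.
  have ctr : continuous (tr (@bump_d2 R)).
    exact: continuous_translates (@continuous_bump_d2 R).
  move=> t; apply: continuousD; first exact: c2.
  by apply: continuousZr; apply: continuousZr; exact: ctr.
have w2E t : w2 t = f2 t + h^-1 * (h^-1 * tr (@bump_d2 R) t) by [].
have wgrid i : (i <= k)%N -> w (grid T k i) = v (grid T k i).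
  move=> ik; rewrite gridE.
  have -> : w (i%:R * h) = f (i%:R * h) + tr (@bump R) (i%:R * h) by [].
  rewrite /tr translates_grid ?gt_eqF ?bump0//; first by rewrite /e addrC subrK.
  by move=> t /bump_out[].
have Cw : Ck_itv 0 T 1 w.
  by have [G [G0 _ hG]] := itv_jet_of_derivatives T dw dw1; exists G.
apply: (le_trans (vmin w Cw wgrid)).
have hw2 : L2_second_derivative T w w2 := L2_second_derivative_continuous T0 dw dw1 cw2.
apply: (@le_trans _ _ (L2norm T w2)); first by apply: ereal_inf_lbound; exists w2.
have Q0 : 0 <= Q.
  by apply: le_trans hQ; rewrite mulr_ge0 ?(ltW h0)// sumr_ge0// => i _; rewrite sqr_ge0.
have bound_ge0 : 0 <= 2 * T * F2 ^+ 2 + 4608 / h ^+ 4 * Q.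
  apply: addr_ge0; first exact: mulr_ge0 (mulr_ge0 (ler0n _ _) (ltW T0)) (sqr_ge0 _).
  exact: mulr_ge0 (divr_ge0 (ler0n _ _) (exprn_ge0 4 (ltW h0))) Q0.
rewrite L2norm_le ?sqrtr_ge0// sqr_sqrtr; last first.
  exact: bound_ge0.
have mw2T : measurable_fun setT (fun t => w2 t ^+ 2).
  by apply: measurable_funX; exact: continuous_measurable_fun.
have mw2 (a b : R) : measurable_fun `[a, b] (fun t => w2 t ^+ 2).
  exact: measurable_funTS.
clear dw dw1 cw2 Cw hw2 wgrid mw2T.
clearbody w2.
rewrite /sqint [in X in (X <= _)%E]Tkh ge0_integral_grid ?(ltW h0)//;
  last by move=> x; exact: sqr_ge0.
(* The bound 24 on [bump_d2] gives [2304 = 4 * 24^2] after squaring sums, and [h ^+ 4] is the square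
   of the scaling [h^-2]. Since a node belongs to at most two cells, the sum over cells has
   [4608]. *)
pose c j := h * (2 * F2 ^+ 2 + 2304 / h ^+ 4 * (e j ^+ 2 + e j.+1 ^+ 2)).
apply: (@le_trans _ _ (\sum_(j < k) (c j)%:E)%E).
  apply: lee_sum => j _; rewrite /c.
  have jh : j.+1%:R * h - j%:R * h = h by rewrite -mulrBl -natr1 addrAC subrr add0r mul1r.
  rewrite -[X in (X * _)%:E]jh; apply: le_integral_itv_cst.
  - by rewrite -subr_ge0 jh ltW.
  - exact: mw2.
  move=> x xj; rewrite sqr_ge0/=.
  have xT : 0 <= x <= T.
    have /andP[x1 x2] := xj; rewrite (le_trans _ x1) ?mulr_ge0 ?(ltW h0)//=.
    by rewrite (le_trans x2)// Tkh ler_pM2r// ler_nat.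
  have k1 : `|tr (@bump_d2 R) x| <= 24 * (`|e j| + `|e j.+1|).
    apply: translates_le => //; first by rewrite ltnS.
    - by move=> t /bump_out[].
    - exact: bump_d2_le.
  have k2 : `|w2 x| <= F2 + 24 * (`|e j| / h ^+ 2 + `|e j.+1| / h ^+ 2).
    rewrite w2E (le_trans (ler_normD _ _))// lerD ?hF2//.
    rewrite mulrA normrM ger0_norm; last by rewrite mulr_ge0// invr_ge0 ltW.
    rewrite -invfM -expr2 -mulrDl mulrA mulrC ler_pM2r ?invr_gt0 ?exprn_gt0//.
  rewrite -[w2 x ^+ 2]real_normK ?num_real//.
  apply: (@le_trans _ _ ((F2 + 24 * (`|e j| / h ^+ 2 + `|e j.+1| / h ^+ 2)) ^+ 2)).
    by rewrite lerXn2r ?nnegrE// (le_trans _ k2).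
  apply: (le_trans (sqr_sum3_le _ _ _)).
  rewrite !exprMn !exprVn -!exprM !real_normK ?num_real// lerD2l.
  rewrite le_eqVlt; apply/orP; left; apply/eqP.
  by field; rewrite gt_eqF.
rewrite sumEFin lee_fin /c -mulr_sumr big_split/= sumr_const card_ord -mulr_sumr.
rewrite mulrDr; apply: lerD.
  rewrite Tkh -[_ *+ k]mulr_natl [leLHS](_ : _ = 2 * (k%:R * h) * F2 ^+ 2); last by ring.
  exact: lexx.
have s2 : \sum_(i < k) (e i ^+ 2 + e i.+1 ^+ 2) <= 2 * \sum_(i < k.+1) e i ^+ 2.
  have := @sum_pairs_le R k 1 1 (fun i => e i ^+ 2) ler01 ler01 (fun i => sqr_ge0 _).
  by under eq_bigr do rewrite !mul1r.
rewrite mulrCA (_ : 4608 / h ^+ 4 * Q = 2304 / h ^+ 4 * (2 * Q)); last by ring.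
apply: ler_wpM2l; first exact: divr_ge0 (ler0n _ _) (exprn_ge0 4 (ltW h0)).
apply: (@le_trans _ _ (h * (2 * \sum_(i < k.+1) e i ^+ 2))); first by rewrite ler_pM2l.
by rewrite mulrCA ler_pM2l.
Qed.

Lemma derivative_increment_le (R : realType) (a b B : R) (g g1 : R -> R) :
  (forall t : R, is_derive t 1 g (g1 t)) ->
  (forall t : R, a <= t <= b -> `|g1 t| <= B) ->
  forall s t : R, a <= s <= b -> a <= t <= b -> `|g t - g s| <= B * (b - a).
Proof.
move=> dg gB.
suff main s t : a <= s -> s <= t -> t <= b -> `|g t - g s| <= B * (b - a).
  move=> s t /andP[sa sb] /andP[ta tb].
  have [st|/ltW ts] := leP s t; first exact: main.
  by rewrite distrC; exact: main.
move=> sa st tb.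
have [c cst ->] : exists2 c, c \in `[s, t] & g t - g s = g1 c * (t - s).
  apply: MVT_segment => //.
  by apply: derivable_within_continuous => x _; case: (dg x).
have {}cst : a <= c <= b.
  by move: cst; rewrite in_itv/= => /andP[sc ct]; rewrite (le_trans sa) ?(le_trans ct).
rewrite normrM [`|t - s|]ger0_norm ?subr_ge0//.
by apply: ler_pM; rewrite ?subr_ge0 ?gB// lerB.
Qed.

(** On a cell the oscillation of [f' - v'] is at most [F2 * h] plus the integral of [|v''|], which
    by Cauchy-Schwarz is at most [h^(1/2)] times the local L2 norm. One more factor [h] leads to the
    error itself, and squaring and integrating over the cell produces [h^4] in front of the squared
    penalty. *)
Lemma interpolation_error (R : realType) (T F2 Q W : R) (k : nat)
    (f f1 f2 v : R -> R) :
  0 < T -> (0 < k)%N ->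
  (forall t : R, is_derive t 1 f (f1 t)) -> (forall t : R, is_derive t 1 f1 (f2 t)) ->
  (forall t : R, 0 <= t <= T -> `|f2 t| <= F2) ->
  0 <= W -> (penalty T v <= (Num.sqrt W)%:E)%E ->
  T / k%:R * \sum_(i < k.+1) (v (grid T k i) - f (grid T k i)) ^+ 2 <= Q ->
  (sqint 0 T (fun t => f t - v t)%R <=
    (20 * Q + 4 * (T / k%:R) ^+ 4 * (2 * W + 2 + T * F2 ^+ 2))%:E)%E.
Proof.
move=> T0 k0 d0 d1 hF2 W0 pW hQ.
have k0' : 0 < k%:R :> R by rewrite ltr0n.
have [h hE] : exists h, h = T / k%:R by exists (T / k%:R).
rewrite -hE in hQ *.
have h0 : 0 < h by rewrite hE divr_gt0.
have Tkh : T = k%:R * h by rewrite hE mulrC divfK// gt_eqF.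
have gridE i : grid T k i = i%:R * h by rewrite /grid hE mulrA.
pose d t := f t - v t.
pose e i := d (i%:R * h).
have {}hQ : h * \sum_(i < k.+1) e i ^+ 2 <= Q.
  apply: le_trans hQ; rewrite ler_pM2l// ler_sum// => i _.
  by rewrite gridE /e /d -sqrrN opprB.
(* The penalty is an infimum: the extra 1 gives the strict inequality that provides a witness [g],
   and costs the constant in [2 * W + 2]. *)
have [_ [g [mg gfin [G [G0 [cG dG] hG]]] <-] gW] :
    exists2 y, [set L2norm T g | g in L2_second_derivative T v] y &
      (y < (Num.sqrt W + 1)%:E)%E.
  by apply: ereal_inf_lt; apply: le_lt_trans pW _; rewrite lte_fin ltrDl.
have sW0 := sqrtr_ge0 W.
have gS : (sqint 0 T g <= (2 * W + 2)%:E)%E.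
  apply: (@le_trans _ _ ((Num.sqrt W + 1) ^+ 2)%:E).
    by rewrite -L2norm_le ?addr_ge0// ltW.
  rewrite lee_fin.
  have sE := sqr_sqrtr W0; have := sqr_ge0 (Num.sqrt W - 1).
  by rewrite -[X in 2 * X]sE; clear; lra.
have [ig _] := sqr_Rintegral_le T0 mg (le_lt_trans gS (ltry _)).
have jhE j : j.+1%:R * h - j%:R * h = h.
  by rewrite -mulrBl -natr1 addrAC subrr add0r mul1r.
have jle (j : nat) : 0 <= j%:R * h by rewrite mulr_ge0// ltW.
have jT (j : 'I_k) : j.+1%:R * h <= T by rewrite Tkh ler_pM2r// ler_nat.
have jlt (j : nat) : j%:R * h < j.+1%:R * h by rewrite -subr_gt0 jhE.
have gg : (sqint 0 T g = \sum_(j < k) sqint (j%:R * h)%R (j.+1%:R * h)%R g)%E.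
  rewrite /sqint [in LHS]Tkh ge0_integral_grid ?(ltW h0)//; first last.
  - by move=> x; exact: sqr_ge0.
  - by rewrite -Tkh; exact: measurable_funX.
pose s j := fine (sqint (j%:R * h) (j.+1%:R * h) g).
have sfin (j : 'I_k) : (sqint (j%:R * h) (j.+1%:R * h) g = (s j)%:E)%E.
  rewrite fineK// ge0_fin_numE ?sqint_ge0//; apply: le_lt_trans (ltry (2 * W + 2)).
  apply: le_trans gS; rewrite gg (bigD1 j)//= leeDl//.
  by apply: sume_ge0 => i _; exact: sqint_ge0.
have sS : \sum_(j < k) s j <= 2 * W + 2.
  by rewrite -lee_fin -sumEFin (le_trans _ gS)// gg lee_sum// => j _; rewrite sfin.
have cv : {within `[0, T], continuous v} by rewrite -G0; exact: cG.
have cf : continuous f.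
  by move=> t; apply/differentiable_continuous/derivable1_diffP; case: (d0 t).
have cd : {within `[0, T], continuous d}.
  have cf' : {within `[0, T], continuous f} by exact: continuous_subspaceT.
  by move=> t; exact: (continuousB (cf' t) (cv t)).
have md (a b : R) : 0 <= a -> b <= T -> measurable_fun `[a, b] (fun t => d t ^+ 2).
  move=> a0 bT; apply: measurable_funX.
  apply: subspace_continuous_measurable_fun => //.
  by apply: continuous_subspaceW cd; apply: subset_itv; rewrite bnd_simp.
rewrite /sqint [in X in (X <= _)%E]Tkh ge0_integral_grid ?(ltW h0)//; last 2 first.
- by rewrite -Tkh; exact: md.
- by move=> x; exact: sqr_ge0.
pose c j := h * ((16 * e j ^+ 2 + 4 * e j.+1 ^+ 2) + (4 * (h ^+ 3 * s j) + 4 * (h ^+ 4 * F2 ^+ 2))).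
apply: (@le_trans _ _ (\sum_(j < k) (c j)%:E)%E).
  apply: lee_sum => j _.
  have jT' := jT j.
  rewrite /c -[X in (X * _)%:E](jhE j); apply: le_integral_itv_cst.
  - exact/ltW/jlt.
  - exact: md.
  move=> x xj; rewrite sqr_ge0/=.
  pose D := \int[@lebesgue_measure R]_(x in `[(j%:R * h)%R, (j.+1%:R * h)%R]) `|g x|.
  have D0 : 0 <= D by apply: Rintegral_ge0.
  have mgj : measurable_fun `[(j%:R * h), (j.+1%:R * h)] g.
    by apply: measurable_funS mg => //; apply: subset_itv; rewrite bnd_simp.
  have DS : D ^+ 2 <= h * s j.
    have := (sqr_Rintegral_le (jlt j) mgj _).2.
    by rewrite sfin jhE -EFinM lee_fin; apply; rewrite ltry.
  have cdj : {within `[(j%:R * h), (j.+1%:R * h)], continuous d}.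
    by apply: continuous_subspaceW cd; apply: subset_itv; rewrite bnd_simp.
  have dd y : y \in `](j%:R * h), (j.+1%:R * h)[ -> is_derive y 1 d (f1 y - G 1%N y).
    rewrite in_itv/= => /andP[y1 y2].
    have dv : is_derive y 1 v (G 1%N y).
      rewrite -G0; apply: dG => //; rewrite in_itv/= (le_lt_trans (jle j) y1)/=.
      exact: lt_le_trans y2 jT'.
    exact: (is_deriveB (d0 y) dv).
  have inc y z : j%:R * h <= y <= j.+1%:R * h -> j%:R * h <= z <= j.+1%:R * h ->
      `|(f1 z - G 1%N z) - (f1 y - G 1%N y)| <= D + F2 * h.
    move=> hy hz.
    have h1 := L2_derivative_increment (jle j) (jlt j) jT' ig hG hy hz.
    have hF2j t : j%:R * h <= t <= j.+1%:R * h -> `|f2 t| <= F2.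
      move=> /andP[t1 t2]; apply: hF2.
      by rewrite (le_trans (jle j) t1) (le_trans t2 jT').
    have h2 := derivative_increment_le d1 hF2j hy hz.
    rewrite jhE in h2.
    rewrite (_ : _ - _ = (f1 z - f1 y) - (G 1%N z - G 1%N y)); last by ring.
    by rewrite (le_trans (ler_normB _ _))// addrC lerD.
  have dx := endpoints_sup_bound (jlt j) cdj dd inc xj.
  rewrite jhE -/(e j) -/(e j.+1) in dx.
  rewrite -[d x ^+ 2]real_normK ?num_real//.
  apply: (@le_trans _ _ ((2 * `|e j| + `|e j.+1| + h * D + h * (F2 * h)) ^+ 2)).
    by rewrite lerXn2r ?nnegrE -?addrA -?mulrDr ?addrA// (le_trans _ dx).
  apply: (le_trans (sqr_sum4_le _ _ _ _)).
  rewrite !real_normK ?num_real// -addrA lerD2l; apply: lerD.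
    rewrite ler_pM2l// exprMn (_ : h ^+ 3 * s j = h ^+ 2 * (h * s j)); last by ring.
    by rewrite ler_pM2l// exprn_gt0.
  by rewrite (_ : (h * (F2 * h)) ^+ 2 = h ^+ 4 * F2 ^+ 2)//; ring.
rewrite sumEFin lee_fin /c -mulr_sumr !big_split/= -!mulr_sumr sumr_const card_ord.
(* An inner node is the left end of one cell and the right end of another, so the weights 16 and 4
   add up to 20. *)
have s2 : \sum_(i < k) (16 * e i ^+ 2 + 4 * e i.+1 ^+ 2) <= 20 * \sum_(i < k.+1) e i ^+ 2.
  have := @sum_pairs_le R k 16 4 (fun i => e i ^+ 2) (ler0n _ _) (ler0n _ _) (fun i => sqr_ge0 _).
  by rewrite -natrD.
rewrite big_split/= -!mulr_sumr in s2.
have s3 : h * (16 * (\sum_(i < k) e i ^+ 2) + 4 * (\sum_(i < k) e i.+1 ^+ 2)) <= 20 * Q.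
  apply: (@le_trans _ _ (h * (20 * \sum_(i < k.+1) e i ^+ 2))); first by rewrite ler_pM2l.
  by rewrite mulrCA ler_pM2l// ltr0n.
have s4 : h ^+ 4 * (\sum_(i < k) s i) <= h ^+ 4 * (2 * W + 2).
  by rewrite ler_pM2l// exprn_gt0.
rewrite -[_ *+ k]mulr_natl.
have s5 : h * (4 * (h ^+ 4 * (F2 * (k%:R * F2)))) = 4 * h ^+ 4 * (T * F2 ^+ 2).
  by rewrite Tkh; ring.
move: s3 s4 s5.
move: (\sum_(i < k) e i ^+ 2) (\sum_(i < k) e i.+1 ^+ 2) (\sum_(i < k) s i) => x y z.
clear; lra.
Qed.

(** * From the transition point to the source *)

Lemma Ck_continuous (R : realType) (m : nat) (g : R -> R) :
  Ck (m + 2) g -> continuous g.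
Proof.
rewrite addn2 => -[hg _] x; apply/differentiable_continuous/derivable1_diffP.
exact: (hg 0%N).
Qed.

Lemma Ck_is_derive2 (R : realType) (m : nat) (g : R -> R) : Ck (m + 2) g ->
  exists g1 g2 : R -> R,
    [/\ forall t : R, is_derive t 1 g (g1 t), forall t : R, is_derive t 1 g1 (g2 t) &
        continuous g2].
Proof.
rewrite addn2 => -[hg cg]; exists (derive1 g), (derive1 (derive1 g)); split.
- move=> t; apply: DeriveDef; first exact: (hg 0%N).
  by rewrite derive1E.
- move=> t; apply: DeriveDef; first exact: (hg 1%N).
  by rewrite [RHS]derive1E.
case: m hg cg => [|m] hg cg; first exact: cg.
move=> x; apply/differentiable_continuous/derivable1_diffP.
exact: (hg 2%N).
Qed.

Lemma periodic_bounded (R : realType) (T : R) (g : R -> R) :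
  0 < T -> periodic g T -> continuous g ->
  exists2 B : R, 0 <= B & forall t : R, 0 <= t -> `|g t| <= B.
Proof.
move=> T0 gT cg.
have [B B0 hB] := continuous_itv_bounded (ltW T0) (continuous_subspaceT cg).
exists B => // t t0.
have tT0 : 0 <= t / T by rewrite divr_ge0// ltW.
have /andP[] := truncn_itv tT0; set n := Num.truncn _ => n1 n2.
rewrite -(subrK (T *+ n) t) periodicn//; apply: hB.
rewrite ler_pdivlMr// mulr_natl in n1.
rewrite ltr_pdivrMr// mulr_natl mulrSr in n2.
by rewrite subr_ge0 n1/= lerBlDl ltW.
Qed.

(** A supremum or infimum bounds the values only when the set is bounded, [sup] and [inf] having
    default values otherwise; continuity and periodicity supply the bounds. *)
Lemma outer_solution_signs (R : realType) (T mubar theta : R) (f u0 u1 : R -> R) :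
  0 < T -> periodic f T -> periodic u0 T -> periodic u1 T ->
  continuous f -> continuous u0 -> continuous u1 ->
  sign_condition mubar theta f u0 u1 ->
  forall x t : R, 0 <= x <= 1 -> 0 <= t -> phil f u0 x t < 0 /\ 0 < phir f u1 x t.
Proof.
move=> T0 fT u0T u1T cf c0 c1 [hl hr _] x t x01 t0.
have [Bf Bf0 hBf] := periodic_bounded T0 fT cf.
have [B0 B00 hB0] := periodic_bounded T0 u0T c0.
have [B1 B10 hB1] := periodic_bounded T0 u1T c1.
have tin : `[0, +oo[%classic t by rewrite /= in_itv/= t0.
have prod_ub (c s : R) : 0 <= c <= 1 -> 0 <= s -> c * f s <= Bf.
  move=> /andP[c0' c1'] s0; apply: (le_trans (ler_norm _)).
  rewrite normrM ger0_norm//; apply: (le_trans _ (hBf s s0)).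
  by rewrite ler_piMl.
split.
- have h1 : u0 t <= sup [set u0 t | t in `[0, +oo[].
    apply: ub_le_sup; last by exists t.
    exists B0 => y [s /=]; rewrite in_itv/= andbT => s0 <-.
    exact: le_trans (ler_norm _) (hB0 s s0).
  have h2 : x * f t <= sup [set x * f t | x in `[0, 1] & t in `[0, +oo[].
    apply: ub_le_sup; last by exists x; [rewrite /= in_itv|exists t].
    exists Bf => y [c /=]; rewrite in_itv/= => c01 [s /=]; rewrite in_itv/= andbT => s0 <-.
    exact: prod_ub.
  move: hl; rewrite lt_min => /andP[_ hl].
  by rewrite /phil; move: h1 h2 hl; clear; lra.
- have h1 : inf [set u1 t | t in `[0, +oo[] <= u1 t.
    apply: ge_inf; last by exists t.
    exists (- B1) => y [s /=]; rewrite in_itv/= andbT => s0 <-.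
    by have := hB1 s s0; rewrite ler_norml => /andP[].
  have h2 : (1 - x) * f t <= sup [set (1 - x) * f t | x in `[0, 1] & t in `[0, +oo[].
    apply: ub_le_sup; last by exists x; [rewrite /= in_itv|exists t].
    exists Bf => y [c /=]; rewrite in_itv/= => c01 [s /=]; rewrite in_itv/= andbT => s0 <-.
    by apply: prod_ub => //; move: c01; clear; lra.
  move: hr; rewrite gt_max => /andP[_ hr].
  by rewrite /phir; move: h1 h2 hr; clear; lra.
Qed.

(** A zero of [Ifun] means [phil = phir] or [phil = - phir], and the signs leave the second. The
    derivative of [Ifun] in [x] is then [- 4 * phir * f], so its negativity forces [f > 0], which is
    the positivity of [F] required by the barrier. *)
Lemma layer_balance (R : realType) (f u0 u1 x0 : R -> R) (t : R) :
  (forall x : R, 0 <= x <= 1 -> phil f u0 x t < 0 /\ 0 < phir f u1 x t) ->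
  limit_layer_position f u0 u1 x0 -> 0 <= t ->
  phil f u0 (x0 t) t = - phir f u1 (x0 t) t /\ 0 < f t.
Proof.
move=> signs pos t0; have [x001 root slope] := pos t t0.
have x001' : 0 <= x0 t <= 1 by case/andP: x001 => /ltW -> /ltW ->.
have [l0 r0] := signs _ x001'.
have lr : phil f u0 (x0 t) t = - phir f u1 (x0 t) t.
  have /eqP := (root _ x001').2 erefl; rewrite /Ifun subr_eq0 eqf_sqr => /orP[|] /eqP //.
  by move=> lrE; move: (lt_trans l0 r0); rewrite lrE ltxx.
split=> //.
have dl : is_derive (x0 t) 1 (fun x => phil f u0 x t) (f t).
  have d := is_deriveD (is_derive_cst (u0 t) (x0 t) 1) (is_derive_affine (f t) 0 (x0 t)).
  apply: is_derive_eqP d _ _ => [x|]; rewrite ?add0r//.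
  by rewrite /phil -[LHS]/(u0 t + f t * (x - 0)); ring.
have dr : is_derive (x0 t) 1 (fun x => phir f u1 x t) (f t).
  have d := is_deriveD (is_derive_cst (u1 t) (x0 t) 1) (is_derive_affine (f t) 1 (x0 t)).
  apply: is_derive_eqP d _ _ => [x|]; rewrite ?add0r//.
  by rewrite /phir -[LHS]/(u1 t + f t * (x - 1)); ring.
have dI := is_deriveB (is_deriveM dl dl) (is_deriveM dr dr).
have {}dI : is_derive (x0 t) 1 ((Ifun f u0 u1)^~ t) (- (4 * phir f u1 (x0 t) t * f t)).
  apply: is_derive_eqP dI _ _ => [x|].
    by rewrite /Ifun !expr2.
  set l := phil f u0 (x0 t) t; set r := phir f u1 (x0 t) t.
  transitivity (l * f t + l * f t - (r * f t + r * f t)) => //.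
  by rewrite /l lr -/r; ring.
move: slope; rewrite /dx derive1E (@derive_val _ _ _ _ _ _ _ dI) oppr_lt0.
by rewrite pmulr_rgt0// mulr_gt0.
Qed.

Lemma layer_sum (R : realType) (f u0 u1 x0 : R -> R) (x t : R) :
  phil f u0 (x0 t) t = - phir f u1 (x0 t) t ->
  phil f u0 x t + phir f u1 x t = 2 * (f t * (x - x0 t)).
Proof. by rewrite /phil /phir => h; move: h; lra. Qed.

(** With [phil = - phir] at [x0], the coefficients of the exponentials in both branches of [U0]
    equal -1, and the two branches become one and the same shock. *)
Lemma initial_profile (R : realType) (f u0 u1 x0 : R -> R) (mu x t : R) :
  phil f u0 (x0 t) t = - phir f u1 (x0 t) t -> 0 < phir f u1 (x0 t) t ->
  U0 f u0 u1 x0 mu x t - f t * (x - x0 t) =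
  phir f u1 (x0 t) t * shock (phir f u1 (x0 t) t / mu * (x - x0 t)).
Proof.
move=> lr r0; rewrite /U0; set r := phir f u1 (x0 t) t in lr r0 *.
rewrite lr; set xi := (x - x0 t) / mu.
have rxi : r / mu * (x - x0 t) = r * xi by rewrite /xi; ring.
have e0 := expR_gt0 (r * xi).
case: ifP => _.
  have -> : (r + 3 * - r) / (r - - r) = -1.
    rewrite (_ : r + 3 * - r = - (r - - r)); last by ring.
    by rewrite mulNr divff// opprK gt_eqF// addr_gt0.
  have -> : phil f u0 x t = - r + f t * (x - x0 t) by move: lr; rewrite /phil; lra.
  rewrite rxi mulN1r opprK mulNr expRN /shock.
  by field; rewrite !gt_eqF ?addr_gt0.
have -> : (- r + 3 * r) / (- r - r) = -1.
  rewrite (_ : - r + 3 * r = - (- r - r)); last by ring.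
  by rewrite mulNr divff// -opprD oppr_eq0 gt_eqF// addr_gt0.
have -> : phir f u1 x t = r + f t * (x - x0 t) by rewrite /r /phir; ring.
rewrite rxi mulN1r opprK /shock.
by field; rewrite gt_eqF ?addr_gt0.
Qed.

(** As [v + f * (x - x0)] is [w] and [vx] is [wx - f], the source [f * w] is absorbed by the
    transport term; what remains on the right is [mu] times the time derivative of
    [f * (x - x0)]. *)
Lemma solves_problem_layer (R : realType) (T mu : R) (f u0 u1 f1 x0 dx0 : R -> R)
    (w : R -> R -> R) :
  (forall t : R, is_derive t 1 f (f1 t)) -> (forall t : R, is_derive t 1 x0 (dx0 t)) ->
  solves_problem T mu f u0 u1 w ->
  layer_solution T mu f f1 x0 dx0 (fun x t => w x t - f t * (x - x0 t)).
Proof.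
move=> df dx0P [[cw reg] pde _ _ _].
have cf : continuous f.
  by move=> t; apply/differentiable_continuous/derivable1_diffP; case: (df t).
have cx0 : continuous x0.
  by move=> t; apply/differentiable_continuous/derivable1_diffP; case: (dx0P t).
split.
  have cw' : {within `[0, 1] `*` `[0, T], continuous (fun p : R * R => w p.1 p.2)}.
    apply: continuous_subspaceW cw => p [p1 p2]; split=> //.
    by move: p2; rewrite /= !in_itv/= => /andP[->].
  have cg : {within `[0, 1] `*` `[0, T],
      continuous (fun p : R * R => f p.2 * (p.1 - x0 p.2))}.
    apply: continuous_subspaceT => p.
    have c1 : (fun q : R * R => f q.2) @ p --> f p.2.
      by apply: (@continuous_comp _ _ _ snd f); [exact: cvg_snd|exact: cf].
    have c2 : (fun q : R * R => x0 q.2) @ p --> x0 p.2.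
      by apply: (@continuous_comp _ _ _ snd x0); [exact: cvg_snd|exact: cx0].
    by apply: cvgM => //; apply: cvgB => //; exact: cvg_fst.
  by move=> p; exact: (continuousB (cw' p) (cg p)).
exists (fun x t => dx w x t - f t), (fun x t => dx (dx w) x t),
  (fun x t => dt w x t - (f t * (- dx0 t) + (x - x0 t) * f1 t)).
move=> x t x01 /andP[t0 tT].
have [[h1 h2 h3] _] := reg x t x01 t0.
have d1 : is_derive x 1 (w^~ t) (dx w x t).
  by have h := derivableP h1; rewrite -derive1E in h.
have d2 : is_derive x 1 ((dx w)^~ t) (dx (dx w) x t).
  by have h := derivableP h2; rewrite -derive1E in h.
have d3 : is_derive t 1 (w x) (dt w x t).
  by have h := derivableP h3; rewrite -derive1E in h.
split.
- exact: (is_deriveB d1 (is_derive_affine (f t) (x0 t) x)).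
- have d := is_deriveB d2 (is_derive_cst (f t) x 1).
  by apply: is_derive_eqP d _ _ => //; rewrite subr0.
- have dy := is_deriveB (is_derive_cst x t 1) (dx0P t).
  have d := is_deriveB d3 (is_deriveM (df t) dy).
  by apply: is_derive_eqP d _ _ => //; rewrite sub0r.
- have := pde x t x01 t0; lra.
Qed.

Lemma layer_coefficients_exist (R : realType) (T : R) (F dF X dX A dA : R -> R) :
  0 < T ->
  (forall t : R, is_derive t 1 F (dF t)) -> continuous dF ->
  (forall t : R, is_derive t 1 X (dX t)) -> continuous dX ->
  (forall t : R, is_derive t 1 A (dA t)) -> continuous dA ->
  (forall t : R, 0 <= t <= T -> [/\ 0 <= X t <= 1, 0 < A t & 0 < F t]) ->
  exists2 B : R, 1 <= B & layer_coefficients T B F dF X dX A dA.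
Proof.
move=> T0 hF cdF hX cdX hA cdA pos.
have cF : continuous F.
  by move=> t; apply/differentiable_continuous/derivable1_diffP; case: (hF t).
have cA : continuous A.
  by move=> t; apply/differentiable_continuous/derivable1_diffP; case: (hA t).
have bounded (g : R -> R) : continuous g ->
    exists2 B : R, 0 <= B & forall t : R, 0 <= t <= T -> `|g t| <= B.
  by move=> cg; exact: continuous_itv_bounded (ltW T0) (continuous_subspaceT cg).
have positive (g : R -> R) : continuous g -> (forall t : R, 0 <= t <= T -> 0 < g t) ->
    exists2 B : R, 0 <= B & forall t : R, 0 <= t <= T -> 1 <= g t * B.
  move=> cg g0; have [c] := EVT_min (ltW T0) (continuous_subspaceT cg).
  rewrite in_itv/= => c0T hc; exists (g c)^-1; first by rewrite invr_ge0 ltW ?g0.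
  by move=> t t0T; rewrite ler_pdivlMr ?g0// mul1r hc// in_itv.
have [b1 b10 hb1] := bounded _ cF.
have [b2 b20 hb2] := bounded _ cdF.
have [b3 b30 hb3] := bounded _ cdX.
have [b4 b40 hb4] := bounded _ cA.
have [b5 b50 hb5] := bounded _ cdA.
have [b6 b60 hb6] := positive _ cF (fun t ht => let: And3 _ _ h := pos t ht in h).
have [b7 b70 hb7] := positive _ cA (fun t ht => let: And3 _ h _ := pos t ht in h).
exists (1 + b1 + b2 + b3 + b4 + b5 + b6 + b7).
  by move: b10 b20 b30 b40 b50 b60 b70; clear; lra.
split=> // t ht; have [X01 A0 F0] := pos t ht.
have le_mulr (c b b' : R) : 0 < c -> 1 <= c * b -> b <= b' -> 1 <= c * b'.
  by move=> c0 h1 h2; apply: (le_trans h1); rewrite ler_pM2l.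
split=> //.
- split.
    by apply: le_mulr (hb7 _ ht) _ => //; move: b10 b20 b30 b40 b50 b60; clear; lra.
  apply: (le_trans (ler_norm _)); apply: (le_trans (hb4 _ ht)).
  by move: b10 b20 b30 b70 b50 b60; clear; lra.
- split.
    by apply: le_mulr (hb6 _ ht) _ => //; move: b10 b20 b30 b40 b50 b70; clear; lra.
  apply: (le_trans (ler_norm _)); apply: (le_trans (hb1 _ ht)).
  by move: b40 b20 b30 b70 b50 b60; clear; lra.
- split.
    by apply: (le_trans (hb5 _ ht)); move: b10 b20 b30 b40 b70 b60; clear; lra.
  by apply: (le_trans (hb2 _ ht)); move: b10 b50 b30 b40 b70 b60; clear; lra.
- by apply: (le_trans (hb3 _ ht)); move: b10 b20 b50 b40 b70 b60; clear; lra.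
Qed.

(** The quantity estimated equals [2 * f * (xtp - x0)]. It is the defect of the exact data in the
    formula for [f], kept undivided because the division by [1 - 2 * xtp] is done with noisy
    data. *)
Lemma transition_point_near (R : realType) (T mubar theta : R) (n : nat)
    (f u0 u1 x0 : R -> R) (u : R -> R -> R -> R) (xtp : R -> R -> R) :
  0 < T -> 0 < mubar ->
  periodic f T -> periodic u0 T -> periodic u1 T ->
  Ck (n + 2) f -> Ck (n + 2) u0 -> Ck (n + 2) u1 -> Ck (n + 2) x0 ->
  (forall mu : R, 0 < mu <= mubar ->
     solves_problem T mu f u0 u1 (fun x t => u x t mu)) ->
  sign_condition mubar theta f u0 u1 ->
  limit_layer_position f u0 u1 x0 ->
  initial_condition mubar f u0 u1 x0 u ->
  transition_point mubar f u0 u1 u xtp ->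
  exists K mu0 : R, [/\ 0 < K, 0 < mu0 <= mubar & mu0 < 1] /\
    forall mu t : R, 0 < mu <= mu0 -> 0 <= t <= T ->
      `|u0 t + u1 t - f t * (1 - 2 * xtp t mu)| <= K * (mu * `|ln mu|).
Proof.
move=> T0 mubar0 fT u0T u1T Cf Cu0 Cu1 Cx0 usol hi hii hiii hxtp.
have signs := outer_solution_signs T0 fT u0T u1T (Ck_continuous Cf) (Ck_continuous Cu0)
  (Ck_continuous Cu1) hi.
have balance (t : R) : 0 <= t -> phil f u0 (x0 t) t = - phir f u1 (x0 t) t /\ 0 < f t.
  by move=> t0; exact: (layer_balance (fun x x01 => signs x t x01 t0) hii t0).
have [f1 [f2 [df1 df2 _]]] := Ck_is_derive2 Cf.
have [p1 [p2 [dp1 dp2 _]]] := Ck_is_derive2 Cu1.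
have [q1 [q2 [dq1 dq2 _]]] := Ck_is_derive2 Cx0.
have cont (g g1 : R -> R) : (forall t : R, is_derive t 1 g (g1 t)) -> continuous g.
  by move=> dg t; apply/differentiable_continuous/derivable1_diffP; case: (dg t).
pose A t := phir f u1 (x0 t) t.
pose dA t := p1 t - ((1 - x0 t) * f1 t + f t * (0 - q1 t)).
have hA (t : R) : is_derive t 1 A (dA t).
  have d1 := is_deriveB (is_derive_cst (1 : R) t 1) (dq1 t).
  have d := is_deriveB (dp1 t) (is_deriveM d1 (df1 t)).
  by apply: is_derive_eqP d _ _.
have cdA : continuous dA.
  move=> t; apply: cvgB; first exact: (cont _ _ dp2).
  apply: cvgD; apply: cvgM.
  - by apply: cvgB; [exact: cvg_cst|exact: (cont _ _ dq1)].
  - exact: (cont _ _ df2).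
  - exact: (cont _ _ df1).
  - by apply: cvgB; [exact: cvg_cst|exact: (cont _ _ dq2)].
have x001 (t : R) : 0 <= t -> 0 <= x0 t <= 1.
  by move=> t0; have [/andP[h1 h2] _ _] := hii t t0; rewrite !ltW.
have [|B B1 coef] := layer_coefficients_exist T0 df1 (cont _ _ df2) dq1 (cont _ _ dq2) hA cdA.
  move=> t /andP[t0 _]; split; [exact: x001| |by case: (balance t t0)].
  by case: (signs _ _ (x001 t t0) t0).
have [C hC] := hiii.
have C00 : 0 <= `|C| by [].
have [K [mu1 [[K0 mu10 mu11] hK]]] := layer_position T0 B1 C00.
exists (2 * B * K), (Num.min mubar mu1); split.
  split; first by rewrite !mulr_gt0// (lt_le_trans _ B1).
    by rewrite lt_min mubar0 mu10 ge_min lexx.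
  by rewrite gt_min mu11 orbT.
move=> mu t /andP[mu0]; rewrite le_min => /andP[mub mu1'] /andP[t0 tT].
have hmu : 0 < mu <= mubar by rewrite mu0.
have hmu1 : 0 < mu <= mu1 by rewrite mu0.
have ht : 0 <= t <= T by rewrite t0.
have [/andP[xt0 xt1] uxtp] := hxtp mu t hmu t0.
have usolmu := usol mu hmu.
have vsol := solves_problem_layer df1 dq1 usolmu.
have [_ _ bl br _] := usolmu.
have [bt ft0] := balance t t0.
have lsum := layer_sum (xtp t mu) bt.
have xclose : `|xtp t mu - x0 t| <= K * (mu * `|ln mu|).
  apply: (hK mu f f1 x0 q1 A dA _ hmu1 coef vsol) ht _.
  - move=> s /andP[s0 _]; rewrite bl//; have [bs _] := balance s s0.
    by move: bs; rewrite /A /phil; clear; lra.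
  - by move=> s /andP[s0 _]; rewrite br// /A /phir; ring.
  - move=> x x01; have [b0 _] := balance 0 (lexx _).
    have [_ r0] := signs _ _ (x001 0 (lexx _)) (lexx _).
    rewrite -(initial_profile mu x b0 r0).
    rewrite opprB addrA subrK.
    apply: (le_trans (hC mu x hmu x01)); rewrite ler_pM2r//; exact: ler_norm.
  - by rewrite !ltW.
  - by rewrite uxtp lsum; field.
have -> : u0 t + u1 t - f t * (1 - 2 * xtp t mu) = 2 * (f t * (xtp t mu - x0 t)).
  by rewrite -lsum /phil /phir; ring.
have [_ _ /(_ t ht)[_ _ [_ fB] _ _]] := coef.
rewrite !normrM (gtr0_norm ft0) ger0_norm// -!mulrA ler_pM2l//.
by apply: ler_pM => //; exact: ltW.
Qed.

(** * Error of the reconstruction *)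

Lemma meshsize_ge (R : realType) (T : R) (k : nat) : (0 < k)%N ->
  T / k%:R <= meshsize T k.
Proof.
case: k => // k _; rewrite /meshsize.
have <- : grid T k.+1 1 - grid T k.+1 0 = T / k.+1%:R by rewrite /grid !mul0r subr0 mul1r.
exact: (le_bigmax _ (fun i : 'I_k.+1 => grid T k.+1 i.+1 - grid T k.+1 i) ord0).
Qed.

Lemma minimizer_penalty (R : realType) (T eps : R) (k : nat) (d : 'I_k.+1 -> R)
    (v : R -> R) : 0 < eps -> is_minimizer T eps d v ->
  forall w, Ck_itv 0 T 1 w ->
    (forall i, (i <= k)%N -> w (grid T k i) = v (grid T k i)) ->
    (penalty T v <= penalty T w)%E.
Proof.
move=> eps0 [_ vmin] w Cw wv; have := vmin w Cw; rewrite /tikhonov.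
have -> : misfit T d w = misfit T d v.
  by rewrite /misfit; congr (_ * _); apply: eq_bigr => i _; rewrite wv// -ltnS.
by rewrite leeD2lE// lee_pmul2l// lte_fin.
Qed.

(** The exact denominator exceeds [2 * a] in absolute value, so noise of at most [a / 2] leaves at
    least [a]. In the numerator the boundary data contribute [2 * delta], the transition point
    [2 * B * delta], and the asymptotic defect [K * eta]. *)
Lemma source_data_error (R : realType) (a B K delta eta : R) (f u0 u1 x u0d u1d xd : R) :
  0 < a -> 0 < delta <= a / 2 -> 0 <= K -> 0 <= eta -> `|f| <= B ->
  x < 1 / 2 - a \/ 1 / 2 + a < x ->
  `|u0d - u0| <= delta -> `|u1d - u1| <= delta -> `|xd - x| <= delta ->
  `|u0 + u1 - f * (1 - 2 * x)| <= K * eta ->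
  `|f - (u0d + u1d) / (1 - 2 * xd)| <= (2 + 2 * B + K) / a * (delta + eta).
Proof.
move=> a0 /andP[d0 da] K0 eta0 fB xa h0 h1 hx hf.
have B0 : 0 <= B by exact: le_trans fB.
have den : a <= `|1 - 2 * xd|.
  move: hx; rewrite ler_norml => /andP[hx1 hx2].
  case: xa => xa.
    by apply: le_trans (ler_norm _); move: xa da hx2; clear; lra.
  by rewrite -normrN; apply: le_trans (ler_norm _); move: xa da hx1; clear; lra.
have den0 : 1 - 2 * xd != 0 by rewrite -normr_gt0 (lt_le_trans a0).
have -> : f - (u0d + u1d) / (1 - 2 * xd) =
  - ((u0d - u0) + (u1d - u1) + (u0 + u1 - f * (1 - 2 * x)) + 2 * (f * (xd - x)))
   / (1 - 2 * xd) by field.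
have num : `|(u0d - u0) + (u1d - u1) + (u0 + u1 - f * (1 - 2 * x)) + 2 * (f * (xd - x))|
    <= (2 + 2 * B + K) * (delta + eta).
  have k1 : `|2 * (f * (xd - x))| <= 2 * (B * delta).
    by rewrite !normrM [`|2|]ger0_norm// ler_pM2l// ler_pM.
  have n1 := ler_normD ((u0d - u0) + (u1d - u1) + (u0 + u1 - f * (1 - 2 * x)))
    (2 * (f * (xd - x))).
  have n2 := ler_normD ((u0d - u0) + (u1d - u1)) (u0 + u1 - f * (1 - 2 * x)).
  have n3 := ler_normD (u0d - u0) (u1d - u1).
  have k2 : 0 <= B * eta by rewrite mulr_ge0.
  have k3 : 0 <= K * delta by rewrite mulr_ge0// ltW.
  by move: n1 n2 n3 k1 k2 k3 h0 h1 hf d0 eta0; clear; lra.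
rewrite normrM normrN normfV.
rewrite ler_pdivrMr ?normr_gt0//; apply: (le_trans num).
rewrite (_ : _ / a * _ * _ =
  (2 + 2 * B + K) * (delta + eta) * (`|1 - 2 * xd| / a)); last by ring.
rewrite ler_peMr ?ler_pdivlMr ?mul1r//.
by apply: mulr_ge0; move: B0 K0 d0 eta0; clear; lra.
Qed.

Lemma reconstruction_error (R : realType) (T F2 C delta eta : R) (k : nat)
    (d : 'I_k.+1 -> R) (eps : R) (f f1 f2 v : R -> R) :
  0 < T -> (0 < k)%N ->
  (forall t : R, is_derive t 1 f (f1 t)) -> (forall t : R, is_derive t 1 f1 (f2 t)) ->
  continuous f2 -> (forall t : R, 0 <= t <= T -> `|f2 t| <= F2) ->
  0 < eps -> is_minimizer T eps d v -> misfit T d v = delta ^+ 2 ->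
  0 < delta -> 0 <= eta -> 0 <= C ->
  (forall i : 'I_k.+1, `|f (grid T k i) - d i| <= C * (delta + eta)) ->
  (sqint 0 T (fun t => f t - v t)%R <=
    ((4 * T * (1 + C ^+ 2)) * (20 + 8 * 4608) * (delta + eta) ^+ 2
      + (T / k%:R) ^+ 4 * (20 * T * F2 ^+ 2 + 8))%:E)%E.
Proof.
move=> T0 k0 d0 d1 c2 hF2 eps0 vmin vmis del0 eta0 C0 hd.
(* One factor 2 comes from squaring a sum, the other from [(k + 1) / k <= 2], since the misfit
   averages over [k + 1] nodes while the mesh width is [T / k]. *)
pose Q := 4 * T * (1 + C ^+ 2) * (delta + eta) ^+ 2.
have k0' : 0 < k%:R :> R by rewrite ltr0n.
have hQ : T / k%:R * \sum_(i < k.+1) (v (grid T k i) - f (grid T k i)) ^+ 2 <= Q.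
  have sum_d : \sum_(i < k.+1) (v (grid T k i) - d i) ^+ 2 = k.+1%:R * delta ^+ 2.
    by rewrite -vmis /misfit mulrA mulfV ?mul1r// pnatr_eq0.
  have sum_le : \sum_(i < k.+1) (v (grid T k i) - f (grid T k i)) ^+ 2 <=
      k.+1%:R * (2 * (1 + C ^+ 2) * (delta + eta) ^+ 2).
    apply: (@le_trans _ _ (\sum_(i < k.+1) (2 * (v (grid T k i) - d i) ^+ 2 +
        2 * (C * (delta + eta)) ^+ 2))).
      apply: ler_sum => i _.
      have h1 : (f (grid T k i) - d i) ^+ 2 <= (C * (delta + eta)) ^+ 2.
        rewrite -[(f _ - _) ^+ 2]real_normK ?num_real// lerXn2r ?nnegrE//.
        by rewrite mulr_ge0// addr_ge0// ltW.
      have h2 := sqr_ge0 ((v (grid T k i) - d i) + (f (grid T k i) - d i)).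
      move: h1 h2; move: (v _) (f _) (d i) ((C * _) ^+ 2) => x y z q.
      rewrite !expr2; clear; lra.
    rewrite big_split/= -mulr_sumr sum_d sumr_const card_ord -[2 * (C * _) ^+ 2 *+ _]mulr_natl.
    rewrite mulrCA -mulrDr ler_pM2l ?ltr0n// exprMn.
    have h3 : delta ^+ 2 <= (delta + eta) ^+ 2.
      by rewrite lerXn2r ?nnegrE ?addr_ge0 ?(ltW del0)// lerDl.
    by move: h3; clear; lra.
  apply: (@le_trans _ _ (T / k%:R * (k.+1%:R * (2 * (1 + C ^+ 2) * (delta + eta) ^+ 2)))).
    by rewrite ler_pM2l// divr_gt0.
  have h4 : k.+1%:R / k%:R <= 2 :> R.
    by rewrite ler_pdivrMr// -natrM ler_nat mul2n -addnn -addn1 leq_add2l.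
  rewrite (_ : T / k%:R * _ =
     T * (2 * (1 + C ^+ 2) * (delta + eta) ^+ 2) * (k.+1%:R / k%:R)); last by ring.
  rewrite (_ : Q = T * (2 * (1 + C ^+ 2) * (delta + eta) ^+ 2) * 2); last by rewrite /Q; ring.
  rewrite ler_wpM2l// mulr_ge0 ?(ltW T0)// mulr_ge0 ?sqr_ge0// mulr_ge0//.
  by rewrite addr_ge0 ?sqr_ge0.
have Q0 : 0 <= Q.
  rewrite /Q; apply: mulr_ge0 (sqr_ge0 _); apply: mulr_ge0.
    by rewrite mulr_ge0 ?(ltW T0).
  by rewrite addr_ge0 ?sqr_ge0.
have pen := penalty_interpolant T0 k0 d0 d1 c2 hF2 (minimizer_penalty eps0 vmin) hQ.
have h0 : 0 < T / k%:R by rewrite divr_gt0.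
have W0 : 0 <= 2 * T * F2 ^+ 2 + 4608 / (T / k%:R) ^+ 4 * Q.
  apply: addr_ge0; first exact: mulr_ge0 (mulr_ge0 (ler0n _ _) (ltW T0)) (sqr_ge0 _).
  exact: mulr_ge0 (divr_ge0 (ler0n _ _) (exprn_ge0 4 (ltW h0))) Q0.
apply: le_trans (interpolation_error T0 k0 d0 d1 hF2 W0 pen hQ) _.
rewrite lee_fin -/Q.
rewrite (_ : _ * (delta + eta) ^+ 2 = (20 + 8 * 4608) * Q); last first.
  by rewrite /Q; ring.
(* The [h^-4] inside the penalty bound meets the [h^4] of the interpolation error, and the
   coefficient of [Q] no longer depends on the mesh. *)
rewrite [leLHS](_ : _ = (20 + 8 * 4608) * Q + (T / k%:R) ^+ 4 * (20 * T * F2 ^+ 2 + 8)).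
  exact: lexx.
move: h0; clear; move: (T / k%:R) => h h0.
by field; rewrite gt_eqF.
Qed.

(** Writing [mu] as [mu^r * mu^(1 - r)], the second factor absorbs the logarithm. *)
Lemma mul_ln_le_powR (R : realType) (r mu : R) : r < 1 -> 0 < mu < 1 ->
  mu * `|ln mu| <= 2 / (1 - r) * mu `^ r.
Proof.
move=> r1 /andP[mu0 mu1].
have s0 : 0 < 1 - r by rewrite subr_gt0.
have L0 : ln mu < 0 by rewrite ln_lt0// mu0.
rewrite ltr0_norm// /powR gt_eqF//.
rewrite -[X in X * _](lnK mu0).
have -> : expR (ln mu) = expR (r * ln mu) * expR (- ((1 - r) * - ln mu)).
  by rewrite -expRD; congr expR; ring.
have L0' : 0 < - ln mu by rewrite oppr_gt0.
have h := mul_expRN_le ((1 - r) * - ln mu).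
have h1 : expR (- ((1 - r) * - ln mu / 2)) <= 1.
  rewrite -[X in _ <= X]expR0 ler_expR oppr_le0.
  by apply: divr_ge0 => //; apply: mulr_ge0; exact: ltW.
have h2 : expR (- ((1 - r) * - ln mu)) * - ln mu <= 2 / (1 - r).
  by rewrite ler_pdivlMr//; move: h h1; clear; lra.
by rewrite -mulrA [leRHS]mulrC ler_pM2l// expR_gt0.
Qed.

Lemma mul_ln_le_sqrt (R : realType) (e C1 : R) : 0 < e -> 0 < C1 ->
  exists2 M : R, 0 <= M & forall mu delta : R, 0 < mu < 1 -> 0 < delta ->
    mu <= C1 * delta `^ (e + 1 / 2) -> mu * `|ln mu| <= M * Num.sqrt delta.
Proof.
move=> e0 C10.
have e2 : 0 < e + 1 / 2 by rewrite addr_gt0// divr_gt0.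
(* The exponent that turns [delta^(e + 1/2)] into [sqrt delta]. It is below 1 exactly because
   [e > 0], which leaves a power of [mu] for the logarithm. *)
pose r := (1 / 2) / (e + 1 / 2).
have r0 : 0 < r by rewrite !divr_gt0.
have r1 : r < 1 by rewrite ltr_pdivrMr//; move: e0; clear; lra.
have M0 : 0 <= 2 / (1 - r) * C1 `^ r.
  by rewrite mulr_ge0 ?powR_ge0// divr_ge0// subr_ge0 ltW.
exists (2 / (1 - r) * C1 `^ r) => // mu delta mu01 del0 hmu.
apply: (le_trans (mul_ln_le_powR r1 mu01)).
rewrite -[leRHS]mulrA ler_wpM2l ?divr_ge0 ?subr_ge0 ?(ltW r1)//.
have /andP[mu0 _] := mu01.
have := @ge0_ler_powR R r (ltW r0) mu (C1 * delta `^ (e + 1 / 2)).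
rewrite !nnegrE ltW// mulr_ge0 ?powR_ge0 ?(ltW C10)// => /(_ isT isT hmu) h.
apply: (le_trans h); rewrite powRM ?powR_ge0 ?(ltW C10)// -powRrM.
rewrite (_ : (e + 1 / 2) * r = 2^-1); last by rewrite /r [LHS]mulrC divfK ?gt_eqF// div1r.
by rewrite powR12_sqrt// ltW.
Qed.

Theorem theorem4 (R : realType) (T mubar theta a : R) (n : nat)
    (f u0 u1 x0 : R -> R) (u : R -> R -> R -> R) (xtp : R -> R -> R)
    (T_gt0 : 0 < T) (mubar_gt0 : 0 < mubar)
    (theta01 : 0 < theta < 1) (a_bound : 0 < a < 1 / 2)
    (f_periodic : periodic f T) (u0_periodic : periodic u0 T)
    (u1_periodic : periodic u1 T)
    (f_smooth : Ck (n + 2) f) (u0_smooth : Ck (n + 2) u0)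
    (u1_smooth : Ck (n + 2) u1)
    (uinit_smooth : forall mu : R, 0 < mu <= mubar ->
       Ck_itv 0 1 (n + 3) (fun x => u x 0 mu))
    (u_sol : forall mu : R, 0 < mu <= mubar ->
       solves_problem T mu f u0 u1 (fun x t => u x t mu))
    (cond_i : sign_condition mubar theta f u0 u1)
    (x0_periodic : periodic x0 T) (x0_smooth : Ck (n + 2) x0)
    (cond_ii : limit_layer_position f u0 u1 x0)
    (cond_iii : initial_condition mubar f u0 u1 x0 u)
    (xtp_def : transition_point mubar f u0 u1 u xtp)
    (u_layer : internal_layer mubar f u0 u1 u xtp)
    (cond_iv : away_from_middle mubar a xtp) :
  (exists C mu0 delta0 : R,
     [/\ 0 < C, 0 < mu0 <= mubar & 0 < delta0] /\
     forall (mu delta : R) (k : nat) (feps : R -> R),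
       0 < mu <= mu0 -> 0 < delta <= delta0 -> (0 < k)%N ->
       is_reconstruction T delta k u0 u1 (fun t => xtp t mu) feps ->
       (L2norm T (fun t => f t - feps t)%R <=
          (C * (mu * `|ln mu| + meshsize T k + Num.sqrt delta))%:E)%E) /\
  (forall e C1 C2 : R, 0 < e -> 0 < C1 -> 0 < C2 ->
     exists C mu0 delta0 : R,
     [/\ 0 < C, 0 < mu0 <= mubar & 0 < delta0] /\
     forall (mu delta : R) (k : nat) (feps : R -> R),
       0 < mu <= mu0 -> 0 < delta <= delta0 -> (0 < k)%N ->
       is_reconstruction T delta k u0 u1 (fun t => xtp t mu) feps ->
       mu <= C1 * delta `^ (e + 1 / 2) ->
       meshsize T k <= C2 * Num.sqrt delta ->
       (L2norm T (fun t => f t - feps t)%R <= (C * Num.sqrt delta)%:E)%E).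
Proof.
have [K [mu0 [[K0 mu0b mu01] near_xtp]]] := transition_point_near T_gt0 mubar_gt0
  f_periodic u0_periodic u1_periodic f_smooth u0_smooth u1_smooth x0_smooth u_sol
  cond_i cond_ii cond_iii xtp_def.
have [f1 [f2 [df1 df2 cf2]]] := Ck_is_derive2 f_smooth.
have [B B0 hB] := continuous_itv_bounded (ltW T_gt0)
  (continuous_subspaceT (Ck_continuous f_smooth)).
have [F2 F20 hF2] := continuous_itv_bounded (ltW T_gt0) (continuous_subspaceT cf2).
have /andP[a0 _] := a_bound.
pose C := (2 + 2 * B + K) / a.
have C0 : 0 <= C by rewrite divr_ge0 ?(ltW a0)//; move: B0 K0; clear; lra.
have [K1 K10 sq_error] : exists2 K1 : R, 0 <= K1 & forall mu delta (k : nat) feps,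
    0 < mu <= mu0 -> 0 < delta <= Num.min 1 (a / 2) -> (0 < k)%N ->
    is_reconstruction T delta k u0 u1 (fun t => xtp t mu) feps ->
    (sqint 0 T (fun t => f t - feps t)%R <=
      (K1 * ((delta + mu * `|ln mu|) ^+ 2 + (T / k%:R) ^+ 2))%:E)%E.
  pose c1 := 4 * T * (1 + C ^+ 2) * (20 + 8 * 4608).
  (* The factor [T ^+ 2] comes from lowering [h^4] to [h^2] by means of [h <= T], which is enough
     for a first-order term in the mesh size. *)
  pose c2 := T ^+ 2 * (20 * T * F2 ^+ 2 + 8).
  have c10 : 0 <= c1.
    apply: mulr_ge0; last exact: addr_ge0 (ler0n _ _) (mulr_ge0 (ler0n _ _) (ler0n _ _)).
    by apply: mulr_ge0; [exact: mulr_ge0 (ler0n _ _) (ltW T_gt0)|rewrite addr_ge0 ?sqr_ge0].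
  have c20 : 0 <= c2.
    apply: mulr_ge0 (sqr_ge0 _) (addr_ge0 _ (ler0n _ _)).
    exact: mulr_ge0 (mulr_ge0 (ler0n _ _) (ltW T_gt0)) (sqr_ge0 _).
  exists (c1 + c2); first exact: addr_ge0.
  move=> mu delta k feps hmu /andP[del0]; rewrite le_min => /andP[_ dela] k0.
  move=> [u0d [u1d [xd [eps [[hu0 hu1 hxd] [eps0 vmin vmis]]]]]].
  have /andP[mup mule] := hmu.
  have hmub : 0 < mu <= mubar.
    by rewrite mup (le_trans mule)//; case/andP: mu0b.
  have k0' : 0 < k%:R :> R by rewrite ltr0n.
  have h0 : 0 < T / k%:R by rewrite divr_gt0.
  have hT : T / k%:R <= T by rewrite ler_pdivrMr// ler_peMr ?(ltW T_gt0)// ler1n.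
  have eta0 : 0 <= mu * `|ln mu| by rewrite mulr_ge0// ltW.
  have hdata (i : 'I_k.+1) : `|f (grid T k i) - source_data u0d u1d xd i| <=
      C * (delta + mu * `|ln mu|).
    have gT : 0 <= grid T k i <= T.
      rewrite /grid divr_ge0 ?mulr_ge0 ?(ltW T_gt0)//= ler_pdivrMr// mulrC.
      by rewrite ler_pM2l// ler_nat -ltnS.
    have /andP[gT0 _] := gT.
    apply: (@source_data_error _ a B K delta _ _ (u0 (grid T k i)) (u1 (grid T k i))
      (xtp (grid T k i) mu)).
    - exact: a0.
    - by rewrite del0.
    - exact: ltW.
    - exact: eta0.
    - exact: hB.
    - by case: (cond_iv _ _ hmub gT0) => /andP[xl xr]; [left|right].
    - exact: hu0.
    - exact: hu1.
    - exact: hxd.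
    - exact: near_xtp.
  have rec := reconstruction_error T_gt0 k0 df1 df2 cf2 hF2 eps0 vmin vmis del0
    eta0 C0 hdata.
  apply: (le_trans rec).
  rewrite lee_fin -/c1 [leRHS]mulrDr; apply: lerD.
    by rewrite ler_wpM2r ?sqr_ge0// lerDl.
  apply: (@le_trans _ _ (c2 * (T / k%:R) ^+ 2)); last by rewrite ler_wpM2r ?sqr_ge0// lerDr.
  rewrite (_ : (T / k%:R) ^+ 4 = (T / k%:R) ^+ 2 * (T / k%:R) ^+ 2); last by rewrite -exprD.
  rewrite mulrAC ler_wpM2r ?sqr_ge0// /c2 ler_wpM2r//.
    apply: addr_ge0 _ (ler0n _ _).
    exact: mulr_ge0 (mulr_ge0 (ler0n _ _) (ltW T_gt0)) (sqr_ge0 _).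
  by rewrite lerXn2r ?nnegrE// ltW.
(* The bound [mu0 < 1] is recorded for the second claim, where the logarithm is compared with a
   power of [mu]. *)
have main : exists C mu0 delta0 : R,
    [/\ 0 < C, 0 < mu0 <= mubar /\ mu0 < 1 & 0 < delta0] /\
    forall (mu delta : R) (k : nat) (feps : R -> R),
      0 < mu <= mu0 -> 0 < delta <= delta0 -> (0 < k)%N ->
      is_reconstruction T delta k u0 u1 (fun t => xtp t mu) feps ->
      (L2norm T (fun t => f t - feps t)%R <=
         (C * (mu * `|ln mu| + meshsize T k + Num.sqrt delta))%:E)%E.
  (* [K1 <= (K1 + 1)^2], so [K1 + 1] is a positive constant that avoids a square root. Noise at most
     1 gives [delta <= sqrt delta], and at most [a / 2] keeps the denominators away from 0. *)
  exists (K1 + 1), mu0, (Num.min 1 (a / 2)); split.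
    split; [by rewrite ltr_wpDl|by []|by rewrite lt_min ltr01 divr_gt0].
  move=> mu delta k feps hmu hdel k0 hrec.
  have := sq_error _ _ _ _ hmu hdel k0 hrec.
  have /andP[del0] := hdel; rewrite le_min => /andP[del1 _].
  have /andP[mup _] := hmu.
  have eta0 : 0 <= mu * `|ln mu| by rewrite mulr_ge0// ltW.
  have h0 : 0 < T / k%:R by rewrite divr_gt0// ltr0n.
  have hmesh := meshsize_ge T k0.
  have sd0 : 0 < Num.sqrt delta by rewrite sqrtr_gt0.
  have dsd : delta <= Num.sqrt delta.
    rewrite -{1}(sqr_sqrtr (ltW del0)) expr2 ler_piMl ?(ltW sd0)//.
    by rewrite -sqrtr1 ler_sqrt.
  set X := mu * `|ln mu| + _ + _.
  have X0 : 0 <= X.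
    by rewrite /X; move: eta0 h0 hmesh sd0; clear; lra.
  move=> herr; rewrite L2norm_le; last by rewrite mulr_ge0// addr_ge0.
  apply: (le_trans herr); rewrite lee_fin [leRHS]exprMn.
  have k1 : (delta + mu * `|ln mu|) ^+ 2 + (T / k%:R) ^+ 2 <= X ^+ 2.
    apply: (@le_trans _ _ ((delta + mu * `|ln mu| + T / k%:R) ^+ 2)).
      rewrite [leRHS]sqrrD lerD2r lerDl mulrn_wge0// mulr_ge0 ?(ltW h0)//.
      by rewrite addr_ge0// ltW.
    rewrite lerXn2r ?nnegrE//.
      by rewrite !addr_ge0// ltW.
    by rewrite /X; move: hmesh dsd; clear; lra.
  apply: (@le_trans _ _ (K1 * X ^+ 2)); first by rewrite ler_wpM2l.
  rewrite ler_wpM2r ?sqr_ge0//.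
  by have := sqr_ge0 K1; rewrite sqrrD expr1n mulr1 mulr2n; move: K10; clear; lra.
have {main}[C' [mu1 [delta1 [[C'0 [mu1b mu11] delta10] main]]]] := main.
split; first by exists C', mu1, delta1.
move=> e C1 C2 e0 C10 C20.
have [M M0 hM] := mul_ln_le_sqrt e0 C10.
exists (C' * (M + C2 + 1)), mu1, delta1; split.
  by split=> //; rewrite mulr_gt0// ltr_wpDl// addr_ge0// ltW.
move=> mu delta k feps hmu hdel k0 hrec hmu_del hmesh.
apply: le_trans (main mu delta k feps hmu hdel k0 hrec) _.
rewrite lee_fin -mulrA ler_pM2l// mulrDl mul1r lerD2r mulrDl lerD//.
have /andP[mup mule] := hmu; have /andP[del0 _] := hdel.
by apply: hM => //; rewrite mup (le_lt_trans mule).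
Qed.
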